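(* (a) Every real maximal dissipative extension and every real maximal accumulative extension of the minimal operator $L_{\min}$ is self-adjoint. (b) For a unitary matrix $K\in\mathbb{C}^{2m\times 2m}$, let $L_K$ (respectively $L^K$) be the self-adjoint extension of $L_{\min}$ that is the restriction of $L_{\max}$ to the set of $y\in\mathrm{Dom}(L_{\max})$ satisfying $(K-I)\Gamma_1y+i(K+I)\Gamma_2y=0$ (respectively $(K-I)\Gamma_1y-i(K+I)\Gamma_2y=0$). Then the self-adjoint extension $L_K$ (respectively $L^K$) is real if and only if the unitary matrix $K$ is symmetric, i.e. $K=K^{T}$.
   Context: Setting. Let $m\in\mathbb{N}$ and let $a=a_0<a_1<\dots<a_m=b$ be a partition of a finite interval $[a,b]$. For each $i\in\{1,\dots,m\}$ let $p_i,Q_i$ be measurable, finite, real-valued functions on $[a_{i-1},a_i]$ such that $$1/p_i,\quad Q_i/p_i,\quad Q_i^2/p_i\in L_1([a_{i-1},a_i],\mathbb{R}).$$ Consider the formal Sturm--Liouville expression $l_i(y)=-(p_i y')'+q_i y$ on $(a_{i-1},a_i)$, where $q_i=Q_i'$ in the sense of distributions. Define quasi-derivatives $$D_i^{[0]}y=y,\qquad D_i^{[1]}y=p_iy'-Q_iy,\qquad D_i^{[2]}y=(D_i^{[1]}y)'+\frac{Q_i}{p_i}D_i^{[1]}y+\frac{Q_i^2}{p_i}y,$$ and interpret $l_i[y]:=-D_i^{[2]}y$. Operators. In $L_2((a_{i-1},a_i),\mathbb{C})$ define the maximal operator $L_{i,1}y=l_i[y]$ with $$\mathrm{Dom}(L_{i,1})=\{y\in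 L_2 : y,\,D_i^{[1]}y\in AC([a_{i-1},a_i],\mathbb{C}),\ D_i^{[2]}y\in L_2\},$$ and the minimal operator $L_{i,0}y=l_i[y]$ with $$\mathrm{Dom}(L_{i,0})=\{y\in\mathrm{Dom}(L_{i,1}) : D_i^{[k]}y(a_{i-1})=D_i^{[k]}y(a_i)=0,\ k=0,1\}.$$ Identify $L_2([a,b],\mathbb{C})$ with $\oplus_{i=1}^m L_2([a_{i-1},a_i],\mathbb{C})$, so that $y=\oplus_i y_i$, and put $L_{\max}=\oplus_{i=1}^m L_{i,1}$, $L_{\min}=\oplus_{i=1}^m L_{i,0}$. The operators $L_{\max},L_{\min}$ are closed and densely defined, $L_{\min}$ is symmetric with deficiency indices $(2m,2m)$, and $L_{\min}^*=L_{\max}$, $L_{\max}^*=L_{\min}$. Boundary maps. For $y\in\mathrm{Dom}(L_{i,1})$, $$\Gamma_{1,i}y:=\bigl(D_i^{[1]}y(a_{i-1}+),\,-D_i^{[1]}y(a_i-)\bigr)\in\mathbb{C}^2,\qquad \Gamma_{2,i}y:=\bigl(y(a_{i-1}+),\,y(a_i-)\bigr)\in\mathbb{C}^2,$$ and for $y=\oplus_i y_i\in\mathrm{Dom}(L_{\max})$, $$\Gamma_1 y := (\Gamma_{1,1}y_1,\dots,\Gamma_{1,m}y_m)\in\mathbb{C}^{2m},\qquad \Gamma_2 y := (\Gamma_{2,1}y_1,\dots,\Gamma_{2,m}y_m)\in\mathbb{C}^{2m}.$$ Conventions. $I$ is the identity on $\mathbb{C}^{2m}$. A densely defined operator $T$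 in a Hilbert space is dissipative (respectively, accumulative) if $\mathrm{Im}(Tf,f)\ge 0$ (respectively, $\le 0$) for all $f\in\mathrm{Dom}(T)$; it is maximal dissipative (respectively, maximal accumulative) if in addition it has no proper dissipative (respectively, accumulative) extension. The inner product is linear in the first argument. A linear operator $T$ acting in $L_2([a,b],\mathbb{C})$ is real if (1) for every $f\in\mathrm{Dom}(T)$ the complex conjugate $\overline f$ also lies in $\mathrm{Dom}(T)$, and (2) $T(\overline f)=\overline{T(f)}$ for every $f\in\mathrm{Dom}(T)$. *)

(* Defs.v *)
From HB Require Import structures.
From mathcomp Require Import all_boot all_order all_algebra.
From mathcomp Require Import generic_quotient ring_quotient.
From mathcomp Require Import complex ring.
From mathcomp Require Import all_classical all_reals all_analysis.
From mathcomp Require Import measurable_realfun lebesgue_integral.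

Set Implicit Arguments.
Unset Strict Implicit.
Unset Printing Implicit Defensive.

Import Order.TTheory GRing.Theory Num.Theory.
Import numFieldNormedType.Exports.

Local Open Scope classical_set_scope.
Local Open Scope ring_scope.
Local Open Scope quotient_scope.

Notation Re := (@complex.Re _).
Notation Im := (@complex.Im _).
Notation normc := ComplexField.Normc.normc.

Section L2.
Context {R : realType}.
Local Notation C := R[i].
Local Notation mu := (@lebesgue_measure R).

Implicit Types (a b : R) (f g : R -> C).

Definition sqintegrable a b f : Prop :=
  [/\ measurable_fun `[a, b] (Re \o f), measurable_fun `[a, b] (Im \o f) &
      mu.-integrable `[a, b] (EFin \o (fun x => normc (f x) ^+ 2))].

Definition sqint a b : {pred R -> C} := fun f => `[< sqintegrable a b f >].

Lemma normc_sqr (z : C) : normc z ^+ 2 = Re z ^+ 2 + Im z ^+ 2.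
Proof. by case: z => u v /=; rewrite sqr_sqrtr// addr_ge0 ?sqr_ge0. Qed.

Lemma normc_comb_le (k z w : C) :
  normc (k * z + w) ^+ 2 <= 2 * normc k ^+ 2 * normc z ^+ 2 + 2 * normc w ^+ 2.
Proof.
rewrite -mulrA -exprMn -ComplexField.Normc.normcM; move: (k * z) => {k}z.
rewrite !normc_sqr -subr_ge0.
have -> : 2 * (Re z ^+ 2 + Im z ^+ 2) + 2 * (Re w ^+ 2 + Im w ^+ 2) -
    (Re (z + w) ^+ 2 + Im (z + w) ^+ 2) =
    (Re z - Re w) ^+ 2 + (Im z - Im w) ^+ 2.
  by case: z w => z1 z2 [w1 w2] /=; ring.
by rewrite addr_ge0 ?sqr_ge0.
Qed.

Lemma ReM (z w : C) : Re (z * w) = Re z * Re w - Im z * Im w.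
Proof. by case: z w => ? ? []. Qed.
Lemma ImM (z w : C) : Im (z * w) = Re z * Im w + Im z * Re w.
Proof. by case: z w => ? ? []. Qed.
Lemma ReD (z w : C) : Re (z + w) = Re z + Re w.
Proof. by case: z w => ? ? []. Qed.
Lemma ImD (z w : C) : Im (z + w) = Im z + Im w.
Proof. by case: z w => ? ? []. Qed.

Lemma measurable_normc2 a b f :
  measurable_fun `[a, b] (Re \o f) -> measurable_fun `[a, b] (Im \o f) ->
  measurable_fun `[a, b] (fun x => normc (f x) ^+ 2).
Proof.
move=> mr mi.
have -> : (fun x => normc (f x) ^+ 2) =
    (fun x => (Re \o f) x ^+ 2 + (Im \o f) x ^+ 2).
  by apply/funext => x; rewrite normc_sqr.
by apply: measurable_funD; exact: measurable_funX.
Qed.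

Lemma sqint_submod_closed a b : submod_closed (sqint a b).
Proof.
split.
  apply/asboolP; split; [exact: measurable_cst | exact: measurable_cst | ].
  have -> : EFin \o (fun x : R => normc ((0 : R -> C) x) ^+ 2) = cst 0%E.
    by apply/funext => x /=; rewrite expr0n addr0 sqrtr0 expr0n.
  exact: integrable0.
move=> k f g /asboolP[fr fi f2] /asboolP[gr gi g2]; apply/asboolP.
have mr : measurable_fun `[a, b] (Re \o (k *: f + g)).
  have -> : Re \o (k *: f + g) =
      (fun x => (Re k * (Re \o f) x - Im k * (Im \o f) x) + (Re \o g) x).
    by apply/funext => x /=; rewrite ReD ReM.
  apply: measurable_funD => //; apply: measurable_funB;
    by apply: measurable_funM.
have mi : measurable_fun `[a, b] (Im \o (k *: f + g)).
  have -> : Im \o (k *: f + g) =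
      (fun x => (Re k * (Im \o f) x + Im k * (Re \o f) x) + (Im \o g) x).
    by apply/funext => x /=; rewrite ImD ImM.
  apply: measurable_funD => //; apply: measurable_funD;
    by apply: measurable_funM.
split=> //.
pose F (x : R) : R := normc (f x) ^+ 2; pose G (x : R) : R := normc (g x) ^+ 2.
have hint : mu.-integrable `[a, b]
    (EFin \o (fun x => 2 * normc k ^+ 2 * F x + 2 * G x)).
  have -> : EFin \o (fun x => 2 * normc k ^+ 2 * F x + 2 * G x) =
    ((fun x => (2 * normc k ^+ 2)%:E * (EFin \o F) x) \+
     (fun x => 2%:E * (EFin \o G) x))%E by [].
  by apply: integrableD => //; exact: integrableZl.
apply: le_integrable hint => //.
- by apply/measurable_EFinP; exact: measurable_normc2.
- move=> x _ /=; rewrite lee_fin !ger0_norm ?sqr_ge0//.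
    exact: normc_comb_le.
  rewrite /F /G; apply: addr_ge0; apply: mulr_ge0; rewrite ?sqr_ge0 ?ler0n //.
  by apply: mulr_ge0; rewrite ?sqr_ge0 ?ler0n.
Qed.

HB.instance Definition _ a b :=
  GRing.isSubmodClosed.Build C (R -> C) (sqint a b) (@sqint_submod_closed a b).

Record L2fun a b := MkL2fun {
  L2fun_val :> R -> C;
  L2funP : L2fun_val \in sqint a b }.

HB.instance Definition _ a b := [isSub for @L2fun_val a b].
HB.instance Definition _ a b := [Choice of L2fun a b by <:].
HB.instance Definition _ a b := [SubChoice_isSubLmodule of L2fun a b by <:].

Definition ae0 a b : {pred L2fun a b} :=
  fun u => `[< ae_eq mu `[a, b]%classic (u : R -> C) (cst 0) >].

Lemma ae0_zmod_closed a b : zmod_closed (@ae0 a b).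
Proof.
split; first by apply/asboolP; exact: aeW.
move=> u v /asboolP u0 /asboolP v0; apply/asboolP.
apply: filterS2 u0 v0 => x u0 v0 Dx.
have -> : ((u - v : L2fun a b) : R -> C) x = u x - v x by [].
by rewrite u0// v0// subr0.
Qed.

HB.instance Definition _ a b :=
  GRing.isZmodClosed.Build (L2fun a b) (@ae0 a b) (@ae0_zmod_closed a b).

Definition L2 a b := Quotient.quot (@ae0 a b).

HB.instance Definition _ a b := Choice.on (L2 a b).
HB.instance Definition _ a b := EqQuotient.on (L2 a b).
HB.instance Definition _ a b := GRing.Zmodule.on (L2 a b).

Lemma L2_eqP a b (u v : L2fun a b) :
  \pi_(L2 a b) u = \pi v <-> ae_eq mu `[a, b]%classic (u : R -> C) v.
Proof.
have -> : (\pi_(L2 a b) u = \pi v) <-> (u - v \in @ae0 a b).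
  by rewrite Quotient.idealrBE; split => [->//|/eqP].
split=> [/asboolP h|h]; last apply/asboolP; apply: filterS h => x h Dx.
  by apply/eqP; rewrite -subr_eq0; apply/eqP; exact: h.
have -> : ((u - v : L2fun a b) : R -> C) x = u x - v x by [].
by rewrite h// subrr.
Qed.

Lemma L2_piD a b (u v : L2fun a b) :
  \pi_(L2 a b) (u + v) = \pi_(L2 a b) u + \pi_(L2 a b) v.
Proof. exact: (Quotient.pi_add (@ae0 a b)). Qed.

Definition L2scale a b (k : C) (x : L2 a b) : L2 a b :=
  \pi_(L2 a b) (k *: (repr x : L2fun a b) : L2fun a b).

Lemma L2scale_pi a b (k : C) (u : L2fun a b) :
  L2scale k (\pi_(L2 a b) u) = \pi_(L2 a b) (k *: u).
Proof.
apply/L2_eqP; have /L2_eqP : \pi_(L2 a b) (repr (\pi_(L2 a b) u)) = \pi u.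
  by rewrite reprK.
by apply: filterS => x h Dx; congr (k * _); exact: h.
Qed.

Lemma L2scaleA a b (k l : C) (x : L2 a b) :
  L2scale k (L2scale l x) = L2scale (k * l) x.
Proof. by elim/quotW: x => u; rewrite (L2scale_pi l) !L2scale_pi scalerA. Qed.

Lemma L2scale1 a b : left_id 1 (@L2scale a b).
Proof. by elim/quotW => u; rewrite L2scale_pi scale1r. Qed.

Lemma L2scaleDr a b : right_distributive (@L2scale a b) +%R.
Proof.
move=> k; elim/quotW => u; elim/quotW => v; rewrite !L2scale_pi.
by rewrite -!L2_piD L2scale_pi scalerDr.
Qed.

Lemma L2scaleDl a b (x : L2 a b) : {morph (@L2scale a b)^~ x : k l / k + l}.
Proof.
move=> k l; elim/quotW: x => u; rewrite !L2scale_pi.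
by rewrite -L2_piD scalerDl.
Qed.

HB.instance Definition _ a b := GRing.Zmodule_isLmodule.Build C (L2 a b)
  (@L2scaleA a b) (@L2scale1 a b) (@L2scaleDr a b) (@L2scaleDl a b).

Definition ip a b (x y : L2 a b) : C :=
  let h t := repr x t * (repr y t)^* in
  Complex (\int[mu]_(t in `[a, b]) Re (h t)) (\int[mu]_(t in `[a, b]) Im (h t)).

Definition L2norm a b (x : L2 a b) : R := Num.sqrt (Re (ip x x)).

(* The class of h in L_2([a, b]); the fallback value 0 is only returned when h *)
(* is not square-integrable on [a, b].                                         *)
Definition L2class a b (h : R -> C) : L2 a b :=
  \pi_(L2 a b) (insubd (0 : L2fun a b) h).

Lemma L2class_ae a b h : h \in sqint a b ->
  ae_eq mu `[a, b]%classic (repr (L2class a b h) : R -> C) h.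
Proof.
move=> hi; have /L2_eqP : \pi_(L2 a b) (repr (L2class a b h)) =
    \pi_(L2 a b) (insubd (0 : L2fun a b) h) by rewrite reprK.
by apply: filterS => x e Dx; rewrite e// -[LHS]/(val _ x) val_insubd hi.
Qed.

Definition L2conj a b (x : L2 a b) : L2 a b :=
  L2class a b (fun t => (repr x t)^*).

Definition L2restr a b c d (x : L2 a b) : L2 c d := L2class c d (repr x).

Lemma L2conj_ae a b (x : L2 a b) :
  ae_eq mu `[a, b]%classic (repr (L2conj x) : R -> C) (fun t => (repr x t)^*).
Proof.
apply: L2class_ae; have /asboolP[xr xi x2] := L2funP (repr x).
apply/asboolP; split.
- have -> // : Re \o (fun t => (repr x t)^*) = Re \o repr x.
  by apply/funext => t /=; case: (repr x t).
- have -> : Im \o (fun t => (repr x t)^*) = \- (Im \o repr x).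
    by apply/funext => t /=; case: (repr x t).
  exact: measurable_funN.
- have -> // : EFin \o (fun t => normc (repr x t)^* ^+ 2) =
    EFin \o (fun t => normc (repr x t) ^+ 2).
  by apply/funext => t /=; rewrite !normc_sqr; case: (repr x t) => u v /=;
    rewrite sqrrN.
Qed.

Lemma L2restr_ae a b c d (x : L2 a b) : a <= c -> d <= b ->
  ae_eq mu `[c, d]%classic (repr (L2restr c d x) : R -> C) (repr x : R -> C).
Proof.
move=> ac db; apply: L2class_ae; have /asboolP[xr xi x2] := L2funP (repr x).
have sub : `[c, d] `<=` `[a, b].
  move=> t /=; rewrite !in_itv/= => /andP[ct td].
  by rewrite (le_trans ac ct) (le_trans td db).
apply/asboolP; split.
- exact: measurable_funS xr.
- exact: measurable_funS xi.
- exact: integrableS x2.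
Qed.

End L2.

Section Operators.
Context {R : realType} (a b : R).
Local Notation H := (L2 a b).

(* An operator is its graph: T (f, g) means f \in Dom T and T f = g.          *)
Definition operator := set (H * H).

Implicit Types T S : operator.

Definition dom T : set H := [set f | exists g, T (f, g)].

Definition linear_operator T : Prop :=
  [/\ T (0, 0),
      forall (k : R[i]) f g Tf Tg, T (f, Tf) -> T (g, Tg) ->
        T (k *: f + g, k *: Tf + Tg) &
      forall f g h, T (f, g) -> T (f, h) -> g = h].

Definition densely_defined T : Prop :=
  forall (f : H) (e : R), 0 < e -> exists2 g, dom T g & L2norm (f - g) < e.

Definition extension T S : Prop := T `<=` S.

Definition adjoint T : operator :=
  [set gh | forall f Tf, T (f, Tf) -> ip Tf gh.1 = ip f gh.2].

Definition self_adjoint T : Prop := densely_defined T /\ adjoint T = T.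

Definition dissipative T : Prop :=
  [/\ linear_operator T, densely_defined T &
      forall f Tf, T (f, Tf) -> 0 <= Im (ip Tf f)].

Definition accumulative T : Prop :=
  [/\ linear_operator T, densely_defined T &
      forall f Tf, T (f, Tf) -> Im (ip Tf f) <= 0].

Definition maximal_dissipative T : Prop :=
  dissipative T /\ forall S, dissipative S -> extension T S -> S = T.

Definition maximal_accumulative T : Prop :=
  accumulative T /\ forall S, accumulative S -> extension T S -> S = T.

Definition real_operator T : Prop :=
  (forall f, dom T f -> dom T (L2conj f)) /\
  (forall f Tf Tcf, T (f, Tf) -> T (L2conj f, Tcf) -> Tcf = L2conj Tf).

End Operators.

Section QuasiDerivatives.
Context {R : realType}.
Local Notation C := R[i].
Local Notation mu := (@lebesgue_measure R).

(* Absolute continuity on [a, b]; only the values of y on [a, b] matter. *)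
Definition AC (a b : R) (y : R -> C) : Prop :=
  forall e : R, 0 < e -> exists2 d : R, 0 < d &
    forall n (s t : 'I_n -> R),
      (forall k, [/\ a <= s k, s k <= t k & t k <= b]) ->
      (forall j k, j != k -> t j <= s k \/ t k <= s j) ->
      \sum_k (t k - s k) < d ->
      \sum_k normc (y (t k) - y (s k)) < e.

(* The AC representative of the a.e. class of h on [a, b]; when it exists it   *)
(* is unique on [a, b].                                                        *)
Definition has_ac_version (a b : R) (h : R -> C) : Prop :=
  exists2 y, AC a b y & ae_eq mu `[a, b]%classic y h.
Definition ac_version (a b : R) (h : R -> C) : R -> C :=
  xget (cst 0) [set y | AC a b y /\ ae_eq mu `[a, b]%classic y h].

Definition cderive (y : R -> C) (x : R) : C :=
  Complex (derive1 (Re \o y) x) (derive1 (Im \o y) x).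

(* The library's measurability on R is Borel; up to an a.e. modification this  *)
(* is Lebesgue measurability.                                                  *)
Definition Lebesgue_measurable (a b : R) (h : R -> R) : Prop :=
  exists2 g, measurable_fun `[a, b] g & ae_eq mu `[a, b]%classic h g.
Definition L1 (a b : R) (h : R -> R) : Prop :=
  exists2 g, mu.-integrable `[a, b] (EFin \o g) & ae_eq mu `[a, b]%classic h g.

(* p <> 0 a.e. is part of 1/p \in L_1, but must be stated since 0^-1 = 0 here. *)
Definition admissible (a b : R) (p Q : R -> R) : Prop :=
  [/\ Lebesgue_measurable a b p /\ Lebesgue_measurable a b Q,
      \forall x \ae mu, `[a, b]%classic x -> p x != 0,
      L1 a b (fun x => 1 / p x),
      L1 a b (fun x => Q x / p x) &
      L1 a b (fun x => Q x ^+ 2 / p x)].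

Section OneInterval.
Variables (a b : R) (p Q : R -> R).
Implicit Types (f g : L2 a b).

(* D0, D1, D2 are the quasi-derivatives; pD1 is p y' - Q y before passing to    *)
(* its AC representative.                                                      *)
Definition D0 f : R -> C := ac_version a b (repr f).

Definition pD1 f (x : R) : C :=
  (p x)%:C%C * cderive (D0 f) x - (Q x)%:C%C * D0 f x.

Definition D1 f : R -> C := ac_version a b (pD1 f).

Definition D2 f (x : R) : C :=
  cderive (D1 f) x + (Q x / p x)%:C%C * D1 f x
  + (Q x ^+ 2 / p x)%:C%C * D0 f x.

(* The condition D2 f \in L_2 is the existence of fg.2 \in L_2 equal to - D2 f *)
(* a.e.                                                                        *)
Definition Lmax1 : operator a b :=
  [set fg : L2 a b * L2 a b |
    [/\ has_ac_version a b (repr fg.1), has_ac_version a b (pD1 fg.1) &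
        ae_eq mu `[a, b]%classic (repr fg.2 : R -> C)
          (fun x => - D2 fg.1 x)]].

Definition Lmin1 : operator a b :=
  [set fg : L2 a b * L2 a b |
    [/\ Lmax1 fg, D0 fg.1 a = 0, D1 fg.1 a = 0, D0 fg.1 b = 0 &
        D1 fg.1 b = 0]].

End OneInterval.
End QuasiDerivatives.

Section SturmLiouville.
Context {R : realType} (m : nat).
Local Notation C := R[i].

(* The partition points are a 0, ..., a m; the i-th interval, i : 'I_m, is     *)
(* [a i, a i.+1], with coefficients p i and Q i.                               *)
Variables (a : nat -> R) (p Q : 'I_m -> R -> R).
Local Notation H := (L2 (a 0%N) (a m)).
Implicit Types (f : H) (K : 'M[C]_(m * 2)).

Definition piece (i : 'I_m) f : L2 (a i) (a i.+1) := L2restr (a i) (a i.+1) f.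

Definition Lmax : operator (a 0%N) (a m) :=
  [set fg : H * H | forall i, Lmax1 (p i) (Q i) (piece i fg.1, piece i fg.2)].

Definition Lmin : operator (a 0%N) (a m) :=
  [set fg : H * H | forall i, Lmin1 (p i) (Q i) (piece i fg.1, piece i fg.2)].

(* mxvec is row-major: the coordinates are grouped by interval. The one-sided  *)
(* limits at the endpoints are the endpoint values of the AC representatives.  *)
Definition Gamma1 f : 'cV[C]_(m * 2) :=
  (mxvec (\matrix_(i < m, j < 2)
    if j == 0 then D1 (p i) (Q i) (piece i f) (a i)
    else - D1 (p i) (Q i) (piece i f) (a i.+1)))^T.

Definition Gamma2 f : 'cV[C]_(m * 2) :=
  (mxvec (\matrix_(i < m, j < 2)
    if j == 0 then D0 (piece i f) (a i) else D0 (piece i f) (a i.+1)))^T.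

Definition L_sub K : operator (a 0%N) (a m) :=
  [set fg : H * H | Lmax fg /\
    (K - 1%:M) *m Gamma1 fg.1 + 'i *: ((K + 1%:M) *m Gamma2 fg.1) = 0].

Definition L_sup K : operator (a 0%N) (a m) :=
  [set fg : H * H | Lmax fg /\
    (K - 1%:M) *m Gamma1 fg.1 - 'i *: ((K + 1%:M) *m Gamma2 fg.1) = 0].

End SturmLiouville.

Arguments Lmax {R m} a p Q.
Arguments Lmin {R m} a p Q.
Arguments Gamma1 {R m} a p Q f.
Arguments Gamma2 {R m} a f.
Arguments L_sub {R m} a p Q K.
Arguments L_sup {R m} a p Q K.

(* Main.v *)
Require Import Defs.
From mathcomp Require Import all_boot all_order all_algebra complex.
From mathcomp Require Import generic_quotient ring_quotient.
From mathcomp Require Import all_classical all_reals all_analysis.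
From mathcomp Require Import ring lra measurable_realfun.
Set Implicit Arguments.
Unset Strict Implicit.
Unset Printing Implicit Defensive.
Import Order.TTheory GRing.Theory Num.Theory numFieldNormedType.Exports.
Local Open Scope classical_set_scope.
Local Open Scope ring_scope.
Local Open Scope quotient_scope.
Local Notation Re := (@complex.Re _).
Local Notation Im := (@complex.Im _).
Local Notation normc := ComplexField.Normc.normc.

(** Part (a) is a fact about any Hilbert space with a conjugation.  If T is real,
    then (T f, f) and (T (conj f), conj f) are complex conjugate, so a sign
    condition on the imaginary part of the form forces the form to be real and T
    to be symmetric.  Given (g, h) in the graph of the adjoint, adjoin it to T: the
    mixed terms of the form of the extension cancel, and its imaginary part is
    |k|^2 Im (h, g), with k the coefficient of g.  When this has the sign required
    of T, maximality puts (g, h) in T; otherwise the conjugate pair, which is also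
    in the adjoint, has the required sign, and T is real
    ([real_maximal_self_adjoint]).

    Part (b) is linear algebra once the boundary maps are understood.  As p and Q
    are real, conjugating y conjugates Gamma_1 y and Gamma_2 y, so the domain of
    [L_K] is stable under conjugation exactly when the boundary condition implies
    its conjugate.  If K is symmetric and unitary then conj K = K^-1, and
    multiplying the conjugate condition by K gives the condition back.  Conversely
    the vectors Gamma_1 = (K + I) w, Gamma_2 = c (K - I) w with c^2 = -1 satisfy
    the condition for every w; when they are boundary values of some y, inserting
    them in the conjugate condition leaves 2 (conj K K - I) w = 0, so that
    conj K = K^-1 = K^* and K = K^T ([real_boundary_condition]).

    It remains to see that all of C^2m x C^2m is reached by (Gamma_1, Gamma_2)
    ([Gamma_surjective]), which is done on each interval separately.  There the
    equation - D^[2] y = h is the first-order system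
      y' = (Q/p) y + z/p,   z' = - (Q/p) z - (Q^2/p) y - h,   z = D^[1] y,
    with integrable coefficients.  Picard iteration solves it
    ([linear_system_solution]).  For a homogeneous solution (u, w) the Wronskian
    y w - z u has derivative h u, so prescribing y and z at both ends amounts to
    prescribing the two integrals of h u_1 and h u_2, where u_1, u_2 come from a
    basis of homogeneous solutions.  Looking for h in the span of u_1 and u_2, this
    is a linear system with the Gram matrix of u_1, u_2, which is invertible because
    a homogeneous solution with u = 0 also has w/p = 0 almost everywhere, hence
    w = 0 ([unobservable_eq0], [steering]).

    Everything about absolute continuity is read off integral representations: the
    functions constructed here are primitives, the product of two primitives is a
    primitive ([primitive_mul]), and a primitive has its integrand as derivative
    almost everywhere.  Quasi-derivatives of arbitrary elements of the domain
    commute with conjugation because absolutely continuous representatives are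
    unique ([AC_ae_eq]). *)

(** * The inner product of L_2 *)

Section InnerProduct.
Context {R : realType} (a b : R).
Local Notation C := R[i].
Local Notation mu := (@lebesgue_measure R).
Local Notation H := (L2 a b).
Implicit Types (f g : R -> C) (x y z : H).

Lemma conjCE (z : C) : z^* = (Re z -i* Im z)%C.
Proof. by case: z. Qed.

Lemma Re_conjC (z : C) : Re z^* = Re z.
Proof. by case: z. Qed.

Lemma Im_conjC (z : C) : Im z^* = - Im z.
Proof. by case: z. Qed.

Lemma sqint_repr x : sqintegrable a b (repr x).
Proof. exact/asboolP/L2funP. Qed.

Lemma normc_mul_le (u v : C) :
  2 * normc (u * v) <= normc u ^+ 2 + normc v ^+ 2.
Proof.
rewrite ComplexField.Normc.normcM -subr_ge0.
rewrite (_ : _ - _ = (normc u - normc v) ^+ 2) ?sqr_ge0//; ring.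
Qed.

Lemma Re_le_normc (u : C) : `|Re u| <= normc u.
Proof. by case: u => x y; rewrite -sqrtr_sqr ler_wsqrtr// lerDl sqr_ge0. Qed.

Lemma Im_le_normc (u : C) : `|Im u| <= normc u.
Proof. by case: u => x y; rewrite -sqrtr_sqr ler_wsqrtr// lerDr sqr_ge0. Qed.

Lemma normc_conj (u : C) : normc u^* = normc u.
Proof. by case: u => u v; rewrite conjCE /= sqrrN. Qed.

Lemma normc_ge0 (u : C) : 0 <= normc u.
Proof. by case: u => u v; rewrite sqrtr_ge0. Qed.

Definition cintegrable f :=
  mu.-integrable `[a, b] (EFin \o (Re \o f)) /\
  mu.-integrable `[a, b] (EFin \o (Im \o f)).

Definition cint f : C :=
  Complex (\int[mu]_(t in `[a, b]) Re (f t)) (\int[mu]_(t in `[a, b]) Im (f t)).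

(** The product is dominated by |f|^2 + |g|^2. *)
Lemma cintegrable_mul_conj f g : sqintegrable a b f -> sqintegrable a b g ->
  cintegrable (fun t => f t * (g t)^*).
Proof.
move=> [fr fi f2] [gr gi g2].
have fg : mu.-integrable `[a, b]
    (EFin \o (fun t => normc (f t) ^+ 2 + normc (g t) ^+ 2)).
  exact: (integrableD _ f2 g2).
have bnd t : normc (f t * (g t)^*) <= normc (f t) ^+ 2 + normc (g t) ^+ 2.
  have := normc_mul_le (f t) (g t)^*; rewrite normc_conj.
  by have := normc_ge0 (f t * (g t)^*); lra.
split; apply: le_integrable fg => //.
- apply/measurable_EFinP.
  have -> : Re \o (fun t => f t * (g t)^*) =
      (fun t => (Re \o f) t * (Re \o g) t + (Im \o f) t * (Im \o g) t).
    by apply/funext => t /=; rewrite Defs.ReM conjCE/=; ring.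
  by apply: measurable_funD => //; apply: measurable_funM.
- move=> t _ /=; rewrite lee_fin [leRHS]ger0_norm ?addr_ge0 ?sqr_ge0//.
  by apply: le_trans (bnd t); exact: Re_le_normc.
- apply/measurable_EFinP.
  have -> : Im \o (fun t => f t * (g t)^*) =
      (fun t => (Im \o f) t * (Re \o g) t - (Re \o f) t * (Im \o g) t).
    by apply/funext => t /=; rewrite Defs.ImM conjCE/=; ring.
  by apply: measurable_funB => //; apply: measurable_funM.
- move=> t _ /=; rewrite lee_fin [leRHS]ger0_norm ?addr_ge0 ?sqr_ge0//.
  by apply: le_trans (bnd t); exact: Im_le_normc.
Qed.

Lemma cint_ae f g : cintegrable f -> cintegrable g ->
  ae_eq mu `[a, b]%classic f g -> cint f = cint g.
Proof.
move=> [fr fi] [gr gi] fg; congr (Complex (fine _) (fine _));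
  apply: ae_eq_integral => //.
- exact: measurable_int fr.
- exact: measurable_int gr.
- by apply: filterS fg => t + Dt => ->.
- exact: measurable_int fi.
- exact: measurable_int gi.
- by apply: filterS fg => t + Dt => ->.
Qed.

Lemma cintD f g : cintegrable f -> cintegrable g ->
  cint (fun t => f t + g t) = cint f + cint g.
Proof.
move=> [fr fi] [gr gi]; rewrite /cint /GRing.add/=; congr Complex.
- by rewrite -RintegralD//; apply: eq_Rintegral => t _; rewrite Defs.ReD.
- by rewrite -RintegralD//; apply: eq_Rintegral => t _; rewrite Defs.ImD.
Qed.

Lemma cintZ (k : C) f : cintegrable f ->
  cint (fun t => k * f t) = k * cint f.
Proof.
move=> [fr fi].
have iZ (c : R) (g : R -> R) : mu.-integrable `[a, b] (EFin \o g) ->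
    mu.-integrable `[a, b] (EFin \o (fun t => c * g t)).
  by move=> gi; exact: (integrableZl _ c gi).
apply/eqP; rewrite eq_complex Defs.ReM Defs.ImM /=; apply/andP; split; apply/eqP.
- rewrite -!RintegralZl// -RintegralB//; try exact: iZ.
  by apply: eq_Rintegral => t _; rewrite Defs.ReM.
- rewrite -!RintegralZl// -RintegralD//; try exact: iZ.
  by apply: eq_Rintegral => t _; rewrite Defs.ImM.
Qed.

Lemma cintegrable_ip x y : cintegrable (fun t => repr x t * (repr y t)^*).
Proof. apply: cintegrable_mul_conj; exact: sqint_repr. Qed.

Lemma ipE x y : ip x y = cint (fun t => repr x t * (repr y t)^*).
Proof. by []. Qed.

(** The quotient chooses representatives, so that pointwise operations on classes
    hold for them only almost everywhere. *)
Lemma repr_pi_ae (u : L2fun a b) :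
  ae_eq mu `[a, b]%classic (repr (\pi_(L2 a b) u) : R -> C) (u : R -> C).
Proof. by apply/L2_eqP; rewrite reprK. Qed.

Lemma reprD_ae x y :
  ae_eq mu `[a, b]%classic (repr (x + y) : R -> C) (fun t => repr x t + repr y t).
Proof.
rewrite -[x in x + _]reprK -[y in _ + y]reprK -L2_piD.
exact: (repr_pi_ae (repr x + repr y)).
Qed.

Lemma reprZ_ae (k : C) x :
  ae_eq mu `[a, b]%classic (repr (k *: x) : R -> C) (fun t => k * repr x t).
Proof.
have -> : k *: x = \pi_(L2 a b) (k *: repr x) by rewrite -L2scale_pi reprK.
exact: (repr_pi_ae (k *: repr x)).
Qed.

Lemma L2_eq_ae x y :
  ae_eq mu `[a, b]%classic (repr x : R -> C) (repr y : R -> C) -> x = y.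
Proof. by move/L2_eqP; rewrite !reprK. Qed.

Lemma ipZDl (k : C) x y z : ip (k *: x + y) z = k * ip x z + ip y z.
Proof.
have ixz := cintegrable_ip x z; have iyz := cintegrable_ip y z.
have ikxz := cintegrable_ip (k *: x) z.
rewrite !ipE -cintZ//.
have e1 : ae_eq mu `[a, b]%classic (fun t => repr (k *: x) t * (repr z t)^*)
    (fun t => k * (repr x t * (repr z t)^*)).
  by apply: filterS (reprZ_ae k x) => t + Dt => /(_ Dt) ->; rewrite mulrA.
have ikxz' : cintegrable (fun t => k * (repr x t * (repr z t)^*)).
  have [u v] := ixz; split.
    have -> : Re \o (fun t => k * (repr x t * (repr z t)^*)) = (fun t =>
     Re k * Re (repr x t * (repr z t)^*) - Im k * Im (repr x t * (repr z t)^*)).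
      by apply/funext => t /=; rewrite Defs.ReM.
    by apply: (integrableB _ (integrableZl _ _ u) (integrableZl _ _ v)).
  have -> : Im \o (fun t => k * (repr x t * (repr z t)^*)) = (fun t =>
     Re k * Im (repr x t * (repr z t)^*) + Im k * Re (repr x t * (repr z t)^*)).
    by apply/funext => t /=; rewrite Defs.ImM.
  by apply: (integrableD _ (integrableZl _ _ v) (integrableZl _ _ u)).
rewrite -(cint_ae ikxz ikxz' e1) -cintD//.
apply: cint_ae; first exact: cintegrable_ip.
  have [u v] := ikxz; have [u' v'] := iyz; split.
    have -> : Re \o (fun t => repr (k *: x) t * (repr z t)^* +
        repr y t * (repr z t)^*) = (fun t => Re (repr (k *: x) t * (repr z t)^*) +
        Re (repr y t * (repr z t)^*)).
      by apply/funext => t /=; rewrite Defs.ReD.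
    exact: integrableD u u'.
  have -> : Im \o (fun t => repr (k *: x) t * (repr z t)^* +
      repr y t * (repr z t)^*) = (fun t => Im (repr (k *: x) t * (repr z t)^*) +
      Im (repr y t * (repr z t)^*)).
    by apply/funext => t /=; rewrite Defs.ImD.
  exact: integrableD v v'.
apply: filterS (reprD_ae (k *: x) y) => t + Dt => /(_ Dt) ->.
by rewrite mulrDl.
Qed.

Lemma ip_conjC x y : ip y x = (ip x y)^*.
Proof.
rewrite conjCE; congr Complex.
  by apply: eq_Rintegral => t _; rewrite !Defs.ReM !conjCE/=; ring.
rewrite -mulN1r -RintegralZl//; last exact: (cintegrable_ip x y).2.
by apply: eq_Rintegral => t _; rewrite !Defs.ImM !conjCE/=; ring.
Qed.

Lemma ip_L2conj x y : ip (L2conj x) (L2conj y) = (ip x y)^*.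
Proof.
have [u v] := cintegrable_ip x y.
have -> : (ip x y)^* = cint (fun t => (repr x t * (repr y t)^*)^*).
  rewrite conjCE /cint /ip /=; congr Complex.
    by apply: eq_Rintegral => t _; rewrite Re_conjC.
  rewrite -mulN1r -RintegralZl//.
  by apply: eq_Rintegral => t _; rewrite Im_conjC mulN1r.
rewrite ipE; apply: cint_ae; first exact: cintegrable_ip.
  split.
    rewrite [X in EFin \o X](_ : _ = Re \o (fun t => repr x t * (repr y t)^*))//.
    by apply/funext => t /=; rewrite Re_conjC.
  rewrite [X in EFin \o X](_ : _ =
    \- (Im \o (fun t => repr x t * (repr y t)^*))).
    exact: integrableN v.
  by apply/funext => t /=; rewrite Im_conjC.
apply: filterS2 (L2conj_ae x) (L2conj_ae y) => t ex ey Dt.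
by rewrite ex// ey// rmorphM.
Qed.

Lemma L2conjK : involutive (@L2conj R a b).
Proof.
move=> x; apply: L2_eq_ae.
apply: filterS2 (L2conj_ae x) (L2conj_ae (L2conj x)) => t ex ey Dt.
by rewrite ey// ex// conjCK.
Qed.

Lemma Re_ip_self x : Re (ip x x) = \int[mu]_(t in `[a, b]) (normc (repr x t) ^+ 2).
Proof.
apply: eq_Rintegral => t _.
by rewrite normc_sqr Defs.ReM conjCE/=; ring.
Qed.

Lemma ip_ge0 x : 0 <= Re (ip x x).
Proof. by rewrite Re_ip_self; apply: Rintegral_ge0 => t _; exact: sqr_ge0. Qed.

Lemma ip_eq0 x : Re (ip x x) = 0 -> x = 0.
Proof.
have [xr xi x2] := sqint_repr x.
have mx := measurable_normc2 xr xi.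
rewrite Re_ip_self /Rintegral => h.
have {}h : (\int[mu]_(t in `[a, b]) (normc (repr x t) ^+ 2)%:E = 0)%E.
  by rewrite -[LHS]fineK ?h// integrable_fin_num.
have {}h : (\int[mu]_(t in `[a, b]) `|(normc (repr x t) ^+ 2)%:E| = 0)%E.
  rewrite -[RHS]h; apply: eq_integral => t _.
  by rewrite /= ger0_norm ?sqr_ge0.
have mE : measurable_fun (`[a, b]%classic : set (measurableTypeR R))
    (fun t => (normc (repr x t) ^+ 2)%:E) by apply/measurable_EFinP.
have {}h : ae_eq mu `[a, b]%classic (fun t => (normc (repr x t) ^+ 2)%:E)
    (cst 0%E) by apply/(ae_eq_integral_abs _ _ mE).
have e0 : (0 : H) = \pi_(L2 a b) (0 : L2fun a b).
  by apply: (addrI (\pi_(L2 a b) (0 : L2fun a b))); rewrite -L2_piD !addr0.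
rewrite e0; apply: L2_eq_ae.
apply: filterS2 h (repr_pi_ae (0 : L2fun a b)) => t ht h0 Dt.
have /eqP := ht Dt; rewrite eqe sqrf_eq0 => /eqP/ComplexField.Normc.eq0_normc ->.
by rewrite h0.
Qed.

End InnerProduct.

(** * Real maximal operators *)

Section RealMaximal.
Context {R : realType} (a b : R).
Local Notation C := R[i].
Local Notation H := (L2 a b).
Implicit Types (x y z f g h : H) (T S : operator a b) (k : C).

Lemma ipZDr k x y z : ip x (k *: y + z) = k^* * ip x y + ip x z.
Proof. by rewrite ip_conjC ipZDl rmorphD rmorphM /= -!ip_conjC. Qed.

Lemma ipDl x y z : ip (x + y) z = ip x z + ip y z.
Proof. by rewrite -[x]scale1r ipZDl mul1r scale1r. Qed.

Lemma ipDr x y z : ip x (y + z) = ip x y + ip x z.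
Proof. by rewrite -[y]scale1r ipZDr rmorph1 mul1r scale1r. Qed.

Lemma ip0l z : ip 0 z = 0.
Proof. by apply: (addrI (ip 0 z)); rewrite -ipDl !addr0. Qed.

Lemma ipZl k x z : ip (k *: x) z = k * ip x z.
Proof. by rewrite -[k *: x]addr0 ipZDl ip0l addr0. Qed.

Lemma ipZr k x z : ip x (k *: z) = k^* * ip x z.
Proof. by rewrite ip_conjC ipZl rmorphM /= -ip_conjC. Qed.

Lemma ipNr x z : ip x (- z) = - ip x z.
Proof. by rewrite -scaleN1r ipZr rmorphN1 mulN1r. Qed.

(** If x is orthogonal to g then |x - g|^2 = |x|^2 + |g|^2, so x cannot be
    approximated better than by 0. *)
Lemma dense_orthogonal_eq0 T x : densely_defined T ->
  (forall g, dom T g -> ip g x = 0) -> x = 0.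
Proof.
move=> dT ort; apply: ip_eq0; apply/eqP; rewrite eq_le ip_ge0 andbT leNgt.
apply/negP => x_gt0.
have [|g Tg] := dT x (L2norm x); first by rewrite /L2norm sqrtr_gt0.
apply/negP; rewrite -leNgt ler_wsqrtr//.
have gx0 := ort g Tg; have xg0 : ip x g = 0 by rewrite ip_conjC gx0 rmorph0.
rewrite ipDl !ipDr -scaleN1r !ipZr !ipZl xg0 gx0.
rewrite rmorphN1 !(mulr0, addr0, add0r) mulN1r mulN1r opprK Defs.ReD.
by rewrite lerDl ip_ge0.
Qed.

(** The sign s covers dissipative (s = 1) and accumulative (s = -1) operators at
    once. *)
Lemma real_maximal_self_adjoint (s : R) T : s != 0 ->
  linear_operator T -> densely_defined T -> real_operator T ->
  (forall f Tf, T (f, Tf) -> 0 <= s * Im (ip Tf f)) ->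
  (forall S, linear_operator S -> densely_defined S ->
     (forall f Sf, S (f, Sf) -> 0 <= s * Im (ip Sf f)) ->
     T `<=` S -> S = T) ->
  self_adjoint T.
Proof.
move=> s0 [T0 Tlin Tfun] Tdense [Tdom Treal] Tpos Tmax.
have Tconj f Tf : T (f, Tf) -> T (L2conj f, L2conj Tf).
  move=> fTf; have [|Tcf cfTcf] := Tdom f; first by exists Tf.
  by rewrite -(Treal f Tf Tcf).
have Im0 f Tf : T (f, Tf) -> Im (ip Tf f) = 0.
  move=> fTf; apply/eqP; rewrite -(mulrI_eq0 _ (mulfI s0)) eq_le Tpos// andbT.
  have := Tpos _ _ (Tconj _ _ fTf).
  by rewrite ip_L2conj Im_conjC mulrN oppr_ge0.
have Tsym f Tf g Tg : T (f, Tf) -> T (g, Tg) -> ip Tf g = ip f Tg.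
  move=> fTf gTg; rewrite [RHS]ip_conjC conjCE.
  have Imk k : Im (k * ip Tf g + k^* * ip Tg f) = 0.
    have := Im0 _ _ (Tlin k _ _ _ _ fTf gTg).
    rewrite ipDl !ipDr !ipZl !ipZr !Defs.ImD (Im0 _ _ gTg) addr0.
    have -> : Im (k * (k^* * ip Tf f)) = 0.
      by rewrite !(Defs.ImM, Defs.ReM, Re_conjC, Im_conjC) (Im0 _ _ fTf); ring.
    by rewrite add0r.
  (* polarization *)
  have := Imk 1; have := Imk 'i%C.
  move: (ip Tf g) (ip Tg f) => [u v] [u' v'].
  rewrite !Defs.ImD !Defs.ImM !Re_conjC !Im_conjC /= => h1 h2.
  by congr Complex; lra.
have Tadj g h : adjoint T (g, h) -> 0 <= s * Im (ip h g) -> T (g, h).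
  move=> /= gh hpos.
  pose S : operator a b :=
    [set fg | exists f Tf k, T (f, Tf) /\ fg = (f + k *: g, Tf + k *: h)].
  have TS : T `<=` S.
    by move=> [f Tf] fTf; exists f, Tf, 0; rewrite !scale0r !addr0.
  suff -> : T = S by exists 0, 0, 1; rewrite !scale1r !add0r.
  apply/esym/Tmax => //.
  - split; first exact: TS.
      move=> k _ _ _ _ [f [Tf [c [fTf [-> ->]]]]] [f' [Tf' [c' [fTf' [-> ->]]]]].
      exists (k *: f + f'), (k *: Tf + Tf'), (k * c + c'); split; first exact: Tlin.
      by rewrite !scalerDr !scalerDl !scalerA; congr pair; rewrite addrACA.
    (* a difference of two values lies in the adjoint over 0, hence is orthogonal
       to the domain *)
    move=> f1 _ _ [f [Tf [c [fTf [-> ->]]]]] [f' [Tf' [c' [fTf' [e ->]]]]].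
    have fE : f - f' = (c' - c) *: g.
      have -> : f = f' + (c' *: g - c *: g) by rewrite addrA -e addrK.
      by rewrite scalerBl addrAC subrr add0r.
    have dT : T (f - f', Tf - Tf').
      by have := Tlin (-1) _ _ _ _ fTf' fTf; rewrite !scaleN1r ![- _ + _]addrC.
    apply/eqP; rewrite -subr_eq0; apply/eqP.
    apply: (dense_orthogonal_eq0 Tdense) => u [Tu uTu].
    have -> : Tf + c *: h - (Tf' + c' *: h) = (Tf - Tf') - (c' - c) *: h.
      by rewrite scalerBl opprD opprB addrACA.
    rewrite ipDr ipNr -(Tsym _ _ _ _ uTu dT) ipZr -(gh _ _ uTu) -ipZr fE.
    exact: subrr.
  - move=> f e e0; have [g' [Tg' gTg'] lt] := Tdense f e e0.
    by exists g' => //; exists Tg'; exact: TS.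
  - move=> _ _ [f [Tf [k [fTf [-> ->]]]]].
    rewrite ipDl !ipDr !ipZl !ipZr (gh _ _ fTf) (ip_conjC h f).
    rewrite !Defs.ImD (Im0 _ _ fTf) add0r.
    have -> : Im (k * (k^* * ip h g)) = normc k ^+ 2 * Im (ip h g).
      by rewrite normc_sqr !(Defs.ImM,Defs.ReM,Re_conjC,Im_conjC); ring.
    rewrite addrA.
    (* the mixed terms are a number and its conjugate *)
    have -> : Im (k^* * (ip h f)^*) + Im (k * ip h f) = 0.
      by rewrite !(Defs.ImM,Defs.ReM,Re_conjC,Im_conjC); ring.
    by rewrite add0r mulrCA mulr_ge0// sqr_ge0.
split=> //; apply/seteqP; split; last first.
  by move=> [g h] gh f Tf fTf; exact: Tsym.
move=> [g h] gh; have [|neg] := leP 0 (s * Im (ip h g)); first exact: Tadj.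
(* conjugation changes the sign of the form *)
have /Tadj : adjoint T (L2conj g, L2conj h).
  move=> f Tf fTf /=; rewrite -[Tf]L2conjK -[f in RHS]L2conjK !ip_L2conj.
  by rewrite (gh _ _ (Tconj _ _ fTf)).
rewrite ip_L2conj Im_conjC mulrN oppr_ge0 => /(_ (ltW neg))/Tconj.
by rewrite !L2conjK.
Qed.

Lemma real_maximal_dissipative_self_adjoint T : real_operator T ->
  maximal_dissipative T -> self_adjoint T.
Proof.
move=> Tr [[Tl Td Tp] Tm]; apply: (real_maximal_self_adjoint (s := 1)) => //.
  by move=> f Tf /Tp; rewrite mul1r.
move=> S Sl Sd Sp TS; apply: Tm => //; split=> // f Sf.
by move=> /Sp; rewrite mul1r.
Qed.

Lemma real_maximal_accumulative_self_adjoint T : real_operator T ->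
  maximal_accumulative T -> self_adjoint T.
Proof.
move=> Tr [[Tl Td Tp] Tm]; apply: (real_maximal_self_adjoint (s := -1)) => //.
- by move=> f Tf /Tp; rewrite mulN1r oppr_ge0.
move=> S Sl Sd Sp TS; apply: Tm => //; split=> // f Sf.
by move=> /Sp; rewrite mulN1r oppr_ge0.
Qed.

End RealMaximal.

(** * Primitives of integrable functions on the line *)

Section Primitives.
Context {R : realType}.
Local Notation mu := (@lebesgue_measure R).
Implicit Types (f g h F G : R -> R) (s t u v x : R).

Definition integr f := mu.-integrable setT (EFin \o f).

Lemma integrS f (A : set R) : integr f -> measurable A ->
  mu.-integrable A (EFin \o f).
Proof. by move=> fi mA; apply: integrableS fi. Qed.

Lemma integr_restrict f (A : set R) : measurable A ->
  mu.-integrable A (EFin \o f) -> integr (f \_ A).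
Proof.
by move=> mA; rewrite integrable_mkcond//= (restrict_EFin f).
Qed.

Lemma integr_measurable f : integr f -> measurable_fun setT f.
Proof. by move=> /(measurable_int mu)/measurable_EFinP. Qed.

Lemma integrD f g : integr f -> integr g -> integr (fun x => f x + g x).
Proof. by move=> fi gi; apply: (integrableD _ fi gi). Qed.

Lemma integrZ c f : integr f -> integr (fun x => c * f x).
Proof. by move=> fi; apply: (integrableZl _ c fi). Qed.

Lemma integr0 : integr (fun=> 0).
Proof. exact: integrable0. Qed.

Lemma integr_abs f : integr f -> integr (fun x => `|f x|).
Proof. by move=> fi; apply: (integrable_abse fi). Qed.

Lemma integr_sum (I : Type) (r : seq I) (f : I -> R -> R) :
  (forall i, integr (f i)) -> integr (fun x => \sum_(i <- r) f i x).
Proof.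
move=> fi; elim: r => [|i r IH].
  by under eq_fun do rewrite big_nil; exact: integr0.
by under eq_fun do rewrite big_cons; exact: integrD.
Qed.

Lemma le_integr f g : measurable_fun setT f -> (forall x, `|f x| <= g x) ->
  integr g -> integr f.
Proof.
move=> mf fg; apply: le_integrable => //; first exact/measurable_EFinP.
by move=> x _ /=; rewrite lee_fin (le_trans (fg x))// ler_norm.
Qed.

Lemma integr_mul f h M : integr f -> measurable_fun setT h ->
  (forall x, `|h x| <= M) -> integr (fun x => f x * h x).
Proof.
move=> fi mh hM; apply: (@le_integr _ (fun x => M * `|f x|)).
- by apply: measurable_funM => //; exact: integr_measurable.
- by move=> x; rewrite normrM mulrC ler_wpM2r.
- exact/integrZ/integr_abs.
Qed.

(** Stated through increments, so that no base point or constant of integration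
    has to be carried along. *)
Definition primitive F f := integr f /\
  forall s t, s <= t -> F t - F s = \int[mu]_(x in `]s, t]) f x.

Definition prim f x := \int[mu]_(t in `]-oo, x]) f t.

Lemma prim_primitive f : integr f -> primitive (prim f) f.
Proof.
by move=> fi; split=> // s t st; rewrite Rintegral_itvB//; exact: integrS.
Qed.

Lemma primitiveD F f G g : primitive F f -> primitive G g ->
  primitive (fun x => F x + G x) (fun x => f x + g x).
Proof.
move=> [fi Ff] [gi Gg]; split=> [|s t st]; first exact: integrD.
by rewrite RintegralD; [rewrite -Ff// -Gg//; ring|by []|exact: integrS..].
Qed.

Lemma primitiveZ c F f : primitive F f ->
  primitive (fun x => c * F x) (fun x => c * f x).
Proof.
move=> [fi Ff]; split=> [|s t st]; first exact: integrZ.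
by rewrite RintegralZl; [rewrite -Ff// mulrBr|by []|exact: integrS].
Qed.

Lemma primitive_cst c : primitive (fun=> c) (fun=> 0).
Proof.
split=> [|s t st]; first exact: integr0.
by rewrite subrr Rintegral_cst// mul0r.
Qed.

Lemma primitive_dist F f s t : primitive F f -> s <= t ->
  `|F t - F s| <= \int[mu]_(x in `]s, t]) `|f x|.
Proof. by move=> [fi Ff] st; rewrite Ff// le_normr_Rintegral//; exact: integrS. Qed.

Lemma primitive_unif_cont F f e : primitive F f -> 0 < e ->
  exists2 d, 0 < d & forall s t, `|t - s| < d -> `|F t - F s| < e.
Proof.
move=> pF e0; have [d [d0 fd]] := integral_normr_continuous pF.1 e0.
exists d => // s t; wlog st : s t / s <= t => [hw|].
  by have [/hw//|/ltW/hw] := leP s t; rewrite distrC (distrC (F t)).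
rewrite ger0_norm ?subr_ge0// => std; apply: le_lt_trans (primitive_dist pF st) _.
have mst : (mu `]s, t]%classic < d%:E)%E.
  by rewrite lebesgue_measure_itv/= lte_fin; case: ifP => _; rewrite lte_fin.
by apply: fd => //; exact: measurable_itv.
Qed.

Lemma primitive_continuous F f : primitive F f -> continuous F.
Proof.
move=> pF x; apply/cvgrPdist_lt => e e0.
have [d d0 H] := primitive_unif_cont pF e0.
by exists d => // y /= xy; apply: H.
Qed.

Lemma primitive_measurable F f : primitive F f -> measurable_fun setT F.
Proof. by move/primitive_continuous/continuous_measurable_fun. Qed.

Lemma primitive_bounded F f : primitive F f -> exists M, forall x, `|F x| <= M.
Proof.
move=> pF; exists (`|F 0| + \int[mu]_x `|f x|) => x.
have H s t : s <= t -> `|F t - F s| <= \int[mu]_x `|f x|.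
  move=> st; apply: le_trans (primitive_dist pF st) _.
  rewrite [leLHS]Rintegral_mkcond; apply: le_Rintegral => //.
  - by apply/integr_restrict => //; apply: integrS => //; exact: integr_abs pF.1.
  - exact: integr_abs pF.1.
  - by move=> y _; rewrite patchE; case: ifP => _ //=; exact: normr_ge0.
rewrite -lerBlDl (le_trans (lerB_dist _ _))//.
by have [/H//|/ltW/H] := leP 0 x; rewrite distrC.
Qed.

(** A local estimate of increments by an additive quantity is global: add it up
    along a partition of mesh less than d. *)
Lemma partition_le F G d : 0 < d ->
  (forall u v, u <= v -> v - u < d -> `|F v - F u| <= G v - G u) ->
  forall s t, s <= t -> `|F t - F s| <= G t - G s.
Proof.
move=> d0 loc s t st.
pose n := (Num.truncn ((t - s) / d)).+1.
have n0 : 0 < n%:R :> R by rewrite ltr0n.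
pose w := (t - s) / n%:R.
have w0 : 0 <= w by rewrite divr_ge0 ?subr_ge0 ?ler0n.
have wd : w < d.
  by rewrite ltr_pdivrMr// mulrC -ltr_pdivrMr// truncnS_gt.
have step k : `|F (s + k%:R * w) - F s| <= G (s + k%:R * w) - G s.
  elim: k => [|k IH]; first by rewrite mul0r addr0 !subrr normr0.
  have := loc (s + k%:R * w) (s + k.+1%:R * w).
  rewrite lerD2l ler_wpM2r ?ler_nat// => /(_ isT).
  have -> : s + k.+1%:R * w - (s + k%:R * w) = w.
    by rewrite -natr1; ring.
  move=> /(_ wd) {}loc.
  have := ler_normD (F (s + k.+1%:R * w) - F (s + k%:R * w)) (F (s + k%:R * w) - F s).
  by rewrite addrA subrK; lra.
have -> : t = s + n%:R * w by rewrite mulrC divfK ?gt_eqF// addrC subrK.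
exact: step.
Qed.

(** On a short interval ]u, v] the increment of F G differs from the integral of
    f G + F g by the integral of f (G v - G) + g (F u - F), which is at most e
    times the integral of |f| + |g| as soon as F and G oscillate by less than e.
    By [partition_le] the same bound holds on every interval, and e is arbitrary. *)
Lemma primitive_mul F f G g : primitive F f -> primitive G g ->
  primitive (fun x => F x * G x) (fun x => f x * G x + F x * g x).
Proof.
move=> pF pG.
have [MF bF] := primitive_bounded pF; have [MG bG] := primitive_bounded pG.
have [fi Ff] := pF; have [gi Gg] := pG.
have mF := primitive_measurable pF; have mG := primitive_measurable pG.
have ifG : integr (fun x => f x * G x) by exact: integr_mul bG.
have iFg : integr (fun x => F x * g x).
  by under eq_fun do rewrite mulrC; exact: integr_mul bF.
have ik := integrD ifG iFg; split=> // s t st.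
pose k x := f x * G x + F x * g x.
pose D x := F x * G x - prim k x.
pose N := prim (fun x => `|f x| + `|g x|).
have [iN pN] := prim_primitive (integrD (integr_abs fi) (integr_abs gi)).
have [_ pk] := prim_primitive ik.
have DN e : 0 < e -> `|D t - D s| <= e * (N t - N s).
  move=> e0.
  have [d1 d10 H1] := primitive_unif_cont pF e0.
  have [d2 d20 H2] := primitive_unif_cont pG e0.
  rewrite mulrBr; apply: (@partition_le D (fun x => e * N x) (Num.min d1 d2)) => //.
    by rewrite lt_min d10.
  move=> u v uv; rewrite lt_min => /andP[vu1 vu2].
  have iuv h : integr h -> mu.-integrable `]u, v] (EFin \o h) by move=> /integrS; exact.
  rewrite -mulrBr /N pN//.
  have -> : D v - D u =
      \int[mu]_(x in `]u, v]) (f x * (G v - G x) + g x * (F u - F x)).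
    rewrite /D; have -> : forall p q r w : R, p - q - (r - w) = p - r - (q - w).
      by move=> *; ring.
    rewrite pk//.
    have -> : F v * G v - F u * G u = (F v - F u) * G v + (G v - G u) * F u by ring.
    rewrite Ff// Gg// -!RintegralZr//; [|exact: iuv..].
    have ifv : integr (fun x => f x * G v).
      by under eq_fun do rewrite mulrC; exact: integrZ.
    have igu : integr (fun x => g x * F u).
      by under eq_fun do rewrite mulrC; exact: integrZ.
    rewrite -RintegralD//; [|exact: iuv..].
    rewrite -RintegralB//; [|exact: (iuv _ (integrD ifv igu))|exact: iuv].
    by apply: eq_Rintegral => x _; ring.
  have bnd x : `]u, v]%classic x ->
      `|f x * (G v - G x) + g x * (F u - F x)| <= e * (`|f x| + `|g x|).
    rewrite /= in_itv/= => /andP[ux xv].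
    have h1 : `|G v - G x| <= e.
      by apply/ltW/H2; rewrite ger0_norm ?subr_ge0//; lra.
    have h2 : `|F u - F x| <= e.
      by apply/ltW/H1; rewrite ler0_norm ?subr_le0 1?ltW//; lra.
    apply: le_trans (ler_normD _ _) _; rewrite !normrM mulrDr.
    by rewrite lerD// mulrC ler_wpM2r.
  have i1 : integr (fun x => f x * (G v - G x) + g x * (F u - F x)).
    apply: integrD; [apply: (@integr_mul _ _ (`|G v| + MG))|
                     apply: (@integr_mul _ _ (`|F u| + MF))] => //.
    - exact: measurable_funB.
    - by move=> x; rewrite (le_trans (ler_normB _ _))// lerD2l.
    - exact: measurable_funB.
    - by move=> x; rewrite (le_trans (ler_normB _ _))// lerD2l.
  apply: le_trans (le_normr_Rintegral _ (iuv _ i1)) _ => //.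
  rewrite -RintegralZl//; last exact: iuv.
  apply: le_Rintegral => //; first exact: (iuv _ (integr_abs i1)).
  exact: (iuv _ (integrZ _ iN)).
have D0 : D t = D s.
  have N0 : 0 <= N t - N s by rewrite /N pN// Rintegral_ge0// => x _; rewrite addr_ge0.
  apply/eqP; rewrite -subr_eq0 -normr_eq0 eq_le normr_ge0 andbT.
  apply/ler_addgt0Pr => e e0; rewrite add0r.
  have := DN (e / (N t - N s + 1)); rewrite divr_gt0 ?ltr_wpDl// => /(_ isT).
  move=> /le_trans; apply.
  by rewrite mulrAC ler_pdivrMr ?ltr_wpDl// ler_wpM2l ?lerDl// ltW.
by move: D0; rewrite /D -pk// => D0; lra.
Qed.

(** Lebesgue's differentiation theorem. *)
Lemma primitive_derive F f : primitive F f ->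
  {ae mu, forall x, derivable F x 1 /\ derive1 F x = f x}.
Proof.
move=> [fi Ff].
have -> : F = (fun x => prim f x + (F 0 - prim f 0)).
  apply/funext => x; have [_ Pf] := prim_primitive fi.
  by have [h|/ltW h] := leP 0 x; have := Ff _ _ h; rewrite -Pf// => ?; lra.
have := @FTC1Ny R f (fun y => integrS fi (measurable_itv _)).
have loc : locally_integrable setT f.
  by apply: open_integrable_locally => //; exact: openT.
move=> /(_ loc); apply: filterS; first exact: (ae_filter_ringOfSetsType mu).
move=> x [dx ex]; split.
  exact: derivableD.
rewrite derive1E deriveD//.
by rewrite derive_cst addr0 -derive1E.
Qed.

End Primitives.

(** * Linear systems with integrable coefficients *)

Section LinearSystem.
Context {R : realType}.
Local Notation mu := (@lebesgue_measure R).
Implicit Types (f g h F G : R -> R) (s t u v x : R).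

Lemma primitive_uniq F G f x0 : primitive F f -> primitive G f ->
  F x0 = G x0 -> F =1 G.
Proof.
move=> [_ pF] [_ pG] e0 x.
by have [h|/ltW h] := leP x0 x; have := pF _ _ h; rewrite -pG// => ?; lra.
Qed.

Lemma le_prim f g x : integr f -> integr g -> (forall t, f t <= g t) ->
  prim f x <= prim g x.
Proof. by move=> fi gi fg; apply: le_Rintegral => //; exact: integrS. Qed.

Lemma normr_prim f x : integr f -> `|prim f x| <= prim (fun t => `|f t|) x.
Proof. by move=> fi; apply: le_normr_Rintegral => //; exact: integrS. Qed.

Lemma prim_eq0 f x : (forall t, t <= x -> f t = 0) -> prim f x = 0.
Proof.
move=> f0; rewrite /prim (@eq_Rintegral _ _ _ _ _ (cst 0)).
  by rewrite Rintegral_cst// mul0r.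
by move=> t; rewrite inE/= in_itv/= => /f0.
Qed.

Lemma primD f g x : integr f -> integr g ->
  prim (fun t => f t + g t) x = prim f x + prim g x.
Proof. by move=> fi gi; apply: RintegralD => //; exact: integrS. Qed.

Lemma primB f g x : integr f -> integr g ->
  prim (fun t => f t - g t) x = prim f x - prim g x.
Proof. by move=> fi gi; apply: RintegralB => //; exact: integrS. Qed.

Lemma prim_sum (I : Type) (r : seq I) (f : I -> R -> R) x :
  (forall i, integr (f i)) ->
  prim (fun t => \sum_(i <- r) f i t) x = \sum_(i <- r) prim (f i) x.
Proof.
move=> fi; elim: r => [|i r IH].
  by rewrite big_nil; apply: prim_eq0 => t _; rewrite big_nil.
rewrite big_cons -IH -primD//; last exact: integr_sum.
by congr prim; apply/funext => t; rewrite big_cons.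
Qed.

Lemma eq_primitive F f G g : F =1 G -> f =1 g ->
  primitive F f -> primitive G g.
Proof. by move=> /funext -> /funext ->. Qed.

Lemma primitiveX F f k : primitive F f ->
  primitive (fun x => F x ^+ k.+1) (fun x => k.+1%:R * (f x * F x ^+ k)).
Proof.
move=> pF; elim: k => [|k IH].
  by apply: eq_primitive pF => x; rewrite ?expr1 ?expr0; ring.
apply: eq_primitive (primitive_mul pF IH) => x; first by rewrite [RHS]exprS.
by rewrite -(@natr1 _ k.+1) !exprS; ring.
Qed.

Variables (I : finType) (A : I -> I -> R -> R) (b : I -> R -> R).
Variables (x0 : R) (c : I -> R).
Hypothesis iA : forall i j, integr (A i j).
(* A0 and b0 make integrals over ]-oo, x] start at x0. *)
Hypothesis A0 : forall i j x, x <= x0 -> A i j x = 0.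
Hypothesis ib : forall i, integr (b i).
Hypothesis b0 : forall i x, x <= x0 -> b i x = 0.

Definition rhs (Y : I -> R -> R) i x := \sum_j A i j x * Y j x + b i x.

Fixpoint picard k : I -> R -> R :=
  if k is k'.+1 then fun i x => c i + prim (rhs (picard k') i) x
  else fun i _ => c i.

Lemma rhs_integr (Y : I -> R -> R) (B : R) :
  (forall i, measurable_fun setT (Y i)) -> (forall i x, `|Y i x| <= B) ->
  forall i, integr (rhs Y i).
Proof.
by move=> mY bY i; apply: integrD => //; apply: integr_sum => j; exact: integr_mul (bY j).
Qed.

Lemma fin_bound (f : I -> R -> R) :
  (forall i, exists M, forall x, `|f i x| <= M) ->
  exists M, forall i x, `|f i x| <= M.
Proof.
move=> /choice[M fM]; exists (\sum_i `|M i|) => i x.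
rewrite (bigD1 i)//= (le_trans (fM i x))// (le_trans (ler_norm _))// lerDl.
exact: sumr_ge0.
Qed.

Lemma picard_primitive k i : primitive (picard k.+1 i) (rhs (picard k) i).
Proof.
suff H : forall i, integr (rhs (picard k) i).
  have := primitiveD (primitive_cst (c i)) (prim_primitive (H i)).
  by under [X in primitive _ X]eq_fun do rewrite add0r.
elim: k {i} => [|k IH] i.
  have [M cM] : exists M, forall i x, `|picard 0 i x| <= M.
    by apply: fin_bound => j; exists `|c j|.
  apply: rhs_integr cM _ => j; exact: measurable_cst.
have pk j : primitive (picard k.+1 j) (rhs (picard k) j).
  have := primitiveD (primitive_cst (c j)) (prim_primitive (IH j)).
  by under [X in primitive _ X]eq_fun do rewrite add0r.
have [M cM] := fin_bound (fun j => primitive_bounded (pk j)).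
by apply: rhs_integr cM _ => j; exact: primitive_measurable (pk j).
Qed.

Lemma picard_integr k i : integr (rhs (picard k) i).
Proof. exact: (picard_primitive k i).1. Qed.

Lemma picard_bounded k : exists M, forall i x, `|picard k i x| <= M.
Proof.
apply: fin_bound => i; case: k => [|k]; first by exists `|c i|.
exact: primitive_bounded (picard_primitive k i).
Qed.

Lemma picard_measurable k i : measurable_fun setT (picard k i).
Proof.
case: k => [|k]; first exact: measurable_cst.
exact: primitive_measurable (picard_primitive k i).
Qed.

Let n x := \sum_i \sum_j `|A i j x|.
Let N := prim n.

Let n_integr : integr n.
Proof. by do 2 apply: integr_sum => ?; exact: integr_abs. Qed.

Let N_primitive : primitive N n. Proof. exact: prim_primitive. Qed.

Let n_eq0 x : x <= x0 -> n x = 0.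
Proof. by move=> xx0; rewrite /n big1// => i _; rewrite big1// => j _; rewrite A0// normr0. Qed.

Let N_ge0 x : 0 <= N x.
Proof. by apply: Rintegral_ge0 => t _; do 2 apply: sumr_ge0 => ? _. Qed.

(** Consecutive iterates differ by at most C N^k / k!, where N is the primitive of
    the sum n of the |A i j|: each integration against n raises the exponent, as
    n N^k / k! has the primitive N^(k+1) / (k+1)!. *)
Lemma picard_step : exists2 C, 0 <= C &
  forall k x, \sum_i `|picard k.+1 i x - picard k i x| <= C * exp_coeff (N x) k.
Proof.
have [M1 hM1] := picard_bounded 1; have [M0 hM0] := picard_bounded 0.
exists (\sum_(i : I) (`|M1| + `|M0|)); first by apply: sumr_ge0 => i _; exact: addr_ge0.
set C := \sum_(i : I) _.
elim=> [|k IH] x.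
  rewrite /exp_coeff /= expr0 fact0 divr1 mulr1; apply: ler_sum => i _.
  apply: le_trans (ler_normB _ _) _.
  by rewrite lerD// (le_trans _ (ler_norm _))//; [exact: hM1|exact: hM0].
pose d x := \sum_i `|picard k.+1 i x - picard k i x|.
have md : measurable_fun setT d.
  apply: measurable_sum => i; apply: measurableT_comp => //.
  by apply: measurable_funB; exact: picard_measurable.
have [B dB] : exists B, forall x, `|d x| <= B.
  have [B1 hB1] := picard_bounded k.+1; have [B0 hB0] := picard_bounded k.
  exists (\sum_(i : I) (B1 + B0)) => y.
  rewrite ger0_norm; last by apply: sumr_ge0.
  apply: ler_sum => i _; rewrite (le_trans (ler_normB _ _))// lerD//.
have pNk : primitive (fun x => C * exp_coeff (N x) k.+1)
    (fun x => n x * (C * exp_coeff (N x) k)).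
  apply: eq_primitive (primitiveZ (C / k.+1`!%:R) (primitiveX k N_primitive)).
    by move=> y; rewrite mulrAC -mulrA.
  move=> y; rewrite /exp_coeff/= factS natrM; field.
  by rewrite nat1r !pnatr_eq0 -!lt0n fact_gt0.
have ind : integr (fun t => n t * d t) by exact: integr_mul dB.
have -> : C * exp_coeff (N x) k.+1 = prim (fun x => n x * (C * exp_coeff (N x) k)) x.
  apply: (primitive_uniq (x0 := x0) pNk (prim_primitive pNk.1)).
  have Nx0 : N x0 = 0 by exact: prim_eq0.
  rewrite /exp_coeff /= Nx0 expr0n mul0r mulr0 prim_eq0// => t tx.
  by rewrite n_eq0 ?mul0r.
apply: (@le_trans _ _ (prim (fun t => n t * d t) x)); last first.
  apply: le_prim => //; first exact: pNk.1.
  move=> t; rewrite ler_wpM2l//; first by do 2 apply: sumr_ge0 => ? _.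
  exact: IH.
have iAd i : integr (fun t => \sum_j `|A i j t| * d t).
  by apply: integr_sum => j; apply: integr_mul dB => //; exact: integr_abs.
have -> : prim (fun t => n t * d t) x = \sum_i prim (fun t => \sum_j `|A i j t| * d t) x.
  rewrite -prim_sum//; congr prim; apply/funext => t.
  by rewrite mulr_suml; apply: eq_bigr => i _; rewrite mulr_suml.
apply: ler_sum => i _.
have ir1 := picard_integr k.+1 i; have ir0 := picard_integr k i.
rewrite [X in `|X|](_ : _ = prim (fun t => rhs (picard k.+1) i t - rhs (picard k) i t) x); last first.
  by rewrite primB//= opprD addrACA subrr add0r.
have irB : integr (fun t => rhs (picard k.+1) i t - rhs (picard k) i t).
  exact: (integrableB _ ir1 ir0).
apply: le_trans (normr_prim _ irB) _; apply: le_prim => //; first exact: integr_abs.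
move=> t; rewrite /rhs opprD addrACA subrr addr0 -sumrB.
apply: le_trans (ler_norm_sum _ _ _) _; apply: ler_sum => j _.
rewrite -mulrBr normrM ler_wpM2l// /d (bigD1 j)//= lerDl.
exact: sumr_ge0.
Qed.

(** The iterates converge pointwise, being dominated by an exponential series, and
    stay bounded; dominated convergence passes to the limit in the integral
    equation. *)
Theorem linear_system_solution : exists Y : I -> R -> R,
  forall i, primitive (Y i) (rhs Y i) /\ Y i x0 = c i.
Proof.
have [C C0 hC] := picard_step.
have step i k x : `|picard k.+1 i x - picard k i x| <= C * exp_coeff (N x) k.
  apply: le_trans (hC k x); rewrite (bigD1 i)//= lerDl; exact: sumr_ge0.
have exp_ser x k : \sum_(0 <= j < k) exp_coeff (N x) j <= expR (N x).
  apply: nondecreasing_cvgn_le; last exact: is_cvg_series_exp_coeff.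
  by apply: nondecreasing_series => j _ _; exact: exp_coeff_ge0.
have bnd i k x : `|picard k i x| <= `|c i| + C * expR (N x).
  apply: (@le_trans _ _ (`|c i| + C * \sum_(0 <= j < k) exp_coeff (N x) j)).
    elim: k => [|k IH]; first by rewrite big_geq// mulr0 addr0.
    rewrite big_nat_recr//= mulrDr addrA -[X in `|X|](subrK (picard k i x)) addrC.
    by apply: le_trans (ler_normD _ _) _; rewrite lerD//; exact: step.
  by rewrite lerD2l ler_wpM2l.
have [MN hMN] := primitive_bounded N_primitive.
pose B := \sum_i `|c i| + C * expR MN.
have bndB i k x : `|picard k i x| <= B.
  apply: le_trans (bnd i k x) _; rewrite lerD//.
    by rewrite (bigD1 i)//= lerDl sumr_ge0.
  by rewrite ler_wpM2l// ler_expR (le_trans (ler_norm _) (hMN x)).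
have cvgP i x : cvgn (fun k => picard k i x).
  have : cvgn (series (telescope (fun k => picard k i x))).
    apply: normed_cvg; apply: (@series_le_cvg _ _ (fun k => C * exp_coeff (N x) k)).
    - by move=> k; exact: normr_ge0.
    - by move=> k; rewrite mulr_ge0// exp_coeff_ge0.
    - by move=> k; exact: step.
    - by apply: is_cvg_seriesZ; exact: is_cvg_series_exp_coeff.
  move=> h.
  rewrite (_ : (fun k => _) = cst (picard 0 i x) + series (telescope (fun k => picard k i x))).
    by apply: is_cvgD; [exact: is_cvg_cst|exact: h].
  by apply/funext => k; rewrite (eq_sum_telescope (fun k => picard k i x)).
pose Y i x := limn (fun k => picard k i x).
have cvgY i x : picard k i x @[k --> \oo] --> Y i x by exact: cvgP.
have mY i : measurable_fun setT (Y i).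
  by apply: measurable_fun_cvg (fun k => picard_measurable k i) _ => x _; exact: cvgY.
have YB i x : `|Y i x| <= B.
  have /limr_le : cvgn (fun k => `|picard k i x|) by apply: is_cvg_norm.
  move=> /(_ B); rewrite lim_norm//; apply; exact: nearW.
have iY i : integr (rhs Y i) by exact: rhs_integr mY YB i.
exists Y => i; suff YE x : Y i x = c i + prim (rhs Y i) x.
  split.
    have := primitiveD (primitive_cst (c i)) (prim_primitive (iY i)).
    under [X in primitive _ X]eq_fun do rewrite add0r.
    by congr primitive; apply/funext => x; rewrite YE.
  rewrite YE prim_eq0 ?addr0// => t tx0; rewrite /rhs b0// addr0 big1// => j _.
  by rewrite A0// mul0r.
have cvg_rhs t : rhs (picard k) i t @[k --> \oo] --> rhs Y i t.
  apply: cvgD; last exact: cvg_cst.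
  apply: cvg_big => [|j _]; first exact: add_continuous.
  by apply: cvgM; [exact: cvg_cst|exact: cvgY].
pose D t := \sum_j `|A i j t| * B + `|b i t|.
have iD : integr D.
  apply: integrD; last exact: integr_abs.
  by apply: integr_sum => j; under eq_fun do rewrite mulrC; exact/integrZ/integr_abs.
have := @dominated_convergence _ _ _ mu `]-oo, x] (measurable_itv _)
  (fun k t => (rhs (picard k) i t)%:E) (fun t => (rhs Y i t)%:E) (EFin \o D).
case.
- by move=> k; exact: measurable_int (integrS (picard_integr k i) (measurable_itv _)).
- exact: measurable_int (integrS (iY i) (measurable_itv _)).
- by apply: aeW => t _; apply: cvg_EFin; [exact: nearW|exact: cvg_rhs].
- exact: integrS.
- apply: aeW => t k _ /=; rewrite lee_fin (le_trans (ler_normD _ _))// lerD2r.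
  apply: le_trans (ler_norm_sum _ _ _) _; apply: ler_sum => j _.
  by rewrite normrM ler_wpM2l.
have finI : (\int[mu]_(t in `]-oo, x]) (rhs Y i t)%:E)%E \is a fin_num.
  by apply: integrable_fin_num => //; exact: integrS (iY i) _.
move=> _ _; rewrite -[X in _ --> X](fineK finI) => /fine_cvg cvI.
have cvS : picard k.+1 i x @[k --> \oo] --> c i + prim (rhs Y i) x.
  by apply: cvgD; [exact: cvg_cst|exact: cvI].
have cvS' : picard k.+1 i x @[k --> \oo] --> Y i x.
  by have := cvgY i x; rewrite -(cvg_shiftS (fun k => picard k i x)).
exact: (cvg_unique _ cvS' cvS).
Qed.

End LinearSystem.

(** * Steering a Sturm--Liouville system between boundary values *)

Section Steering.
Context {R : realType}.
Local Notation mu := (@lebesgue_measure R).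
Implicit Types (f g h y z u w : R -> R) (x : R).

Lemma aeS (P Q : R -> Prop) : (forall x, P x -> Q x) ->
  {ae mu, forall x, P x} -> {ae mu, forall x, Q x}.
Proof. by move=> H; apply: (@filterS _ _ (ae_filter_ringOfSetsType mu)). Qed.

Lemma aeS2 (P Q S : R -> Prop) : (forall x, P x -> Q x -> S x) ->
  {ae mu, forall x, P x} -> {ae mu, forall x, Q x} -> {ae mu, forall x, S x}.
Proof. by move=> H; apply: (@filterS2 _ _ (ae_filter_ringOfSetsType mu)). Qed.

Lemma aeS3 (P Q S T : R -> Prop) : (forall x, P x -> Q x -> S x -> T x) ->
  {ae mu, forall x, P x} -> {ae mu, forall x, Q x} -> {ae mu, forall x, S x} ->
  {ae mu, forall x, T x}.
Proof. by move=> H; apply: (@filterS3 _ _ (ae_filter_ringOfSetsType mu)). Qed.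

Lemma lebesgue_measure_oc_lty (a b : R) : (mu `]a, b]%classic < +oo)%E.
Proof. by rewrite lebesgue_measure_itv/= lte_fin; case: ifP => _; rewrite ltry. Qed.

Lemma bounded_integrable f (a b M : R) :
  measurable_fun setT f -> (forall x, `|f x| <= M) ->
  mu.-integrable `]a, b] (EFin \o f).
Proof.
move=> mf bf; apply: measurable_bounded_integrable => //.
- exact: lebesgue_measure_oc_lty.
- exact: measurable_funS mf.
- exists M; split => [|m Mm]; first exact: num_real.
  by move=> x _; rewrite /= (le_trans _ (ltW Mm)).
Qed.

Lemma bounded_mul_integrable f g (a b M M' : R) :
  measurable_fun setT f -> measurable_fun setT g ->
  (forall x, `|f x| <= M) -> (forall x, `|g x| <= M') ->
  mu.-integrable `]a, b] (EFin \o (fun x => f x * g x)).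
Proof.
move=> mf mg bf bg; apply: (@bounded_integrable _ _ _ (M * M')).
  exact: measurable_funM.
by move=> x; rewrite normrM ler_pM.
Qed.

Lemma ae_itv_witness (a b : R) (P : R -> Prop) (c d : R) :
  {ae mu, forall x, `[a, b]%classic x -> P x} -> a <= c -> c < d -> d <= b ->
  exists2 x, c < x < d & P x.
Proof.
move=> [N [mN N0 sub]] ac cd db; apply: contrapT => noP.
have sN : `]c, d[ `<=` N.
  move=> x /= xcd; apply: sub => /= H; apply: noP; exists x.
    by move: xcd; rewrite in_itv.
  apply: H; move: xcd; rewrite /= !in_itv/= => /andP[cx xd].
  by rewrite (le_trans ac (ltW cx)) (le_trans (ltW xd) db).
have : (mu `]c, d[%classic <= mu N)%E by apply: le_measure; rewrite ?inE.
by rewrite N0 lebesgue_measure_itv/= lte_fin cd -EFinD lee_fin subr_le0 leNgt cd.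
Qed.

(** A property valid almost everywhere holds at points arbitrarily close to any
    given one: this turns equality almost everywhere into equality for continuous
    functions. *)
Lemma ae_itv_near (a b x d : R) (P : R -> Prop) : a < b -> 0 < d ->
  {ae mu, forall x, `[a, b]%classic x -> P x} -> a <= x <= b ->
  exists t, [/\ a <= t <= b, `|x - t| < d & P t].
Proof.
move=> ab d0 aeP /andP[ax xb].
pose c := Num.max a (x - d); pose c' := Num.min b (x + d).
have cc' : c < c'.
  rewrite /c /c' gt_max !lt_min ab.
  by apply/andP; split; [|apply/andP; split]; lra.
have [||t /andP[ct tc'] Pt] := ae_itv_witness aeP _ cc' _.
- by rewrite le_max lexx.
- by rewrite ge_min lexx.
move: ct tc'; rewrite /c /c' gt_max lt_min => /andP[a_t h1] /andP[tb h2].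
exists t; split=> //; first by rewrite !ltW.
by rewrite ltr_norml; apply/andP; split; lra.
Qed.

Lemma continuous_ae_eq0 f (a b : R) : continuous f -> a < b ->
  {ae mu, forall x, `[a, b]%classic x -> f x = 0} ->
  forall x, a <= x <= b -> f x = 0.
Proof.
move=> cf ab f0 x xab; apply/eqP; rewrite -normr_eq0 eq_le normr_ge0 andbT.
apply/ler_addgt0Pr => e e0; rewrite add0r.
have /cvgrPdist_lt/(_ e e0)[d /= d0 xd] := cf x.
have [t [_ xt ft]] := ae_itv_near ab d0 f0 xab.
by have := xd t xt; rewrite ft subr0 => /ltW.
Qed.

Lemma ae_neq_endpoints (a b : R) : {ae mu, forall x, x != a /\ x != b}.
Proof.
exists [set a; b]; split.
- by apply: measurableU; exact: measurable_set1.
- apply: countable_lebesgue_measure0.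
  by apply: finite_set_countable; rewrite finite_setU; split; exact: finite_set1.
- move=> x /= /not_andP[] /negP; rewrite negbK => /eqP ->; by [left|right].
Qed.

Lemma ae_itv_oo (a b : R) (P : R -> Prop) : {ae mu, forall x, a < x < b -> P x} ->
  {ae mu, forall x, `[a, b]%classic x -> P x}.
Proof.
apply: aeS2 (ae_neq_endpoints a b) => x [xa xb] Px.
rewrite /= in_itv/= => /andP[ax bx]; apply: Px.
by rewrite !lt_neqAle ax bx xb eq_sym xa.
Qed.

(** The first-order form of the quasi-differential equation with forcing h. *)
Definition sl_system (s r q h y z : R -> R) :=
  primitive y (fun x => s x * y x + r x * z x) /\
  primitive z (fun x => - (s x * z x) - q x * y x - h x).

Section System.
Variables (s r q : R -> R) (a : R).
Hypotheses (si : integr s) (ri : integr r) (qi : integr q).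
Hypotheses (s0 : forall x, x <= a -> s x = 0) (r0 : forall x, x <= a -> r x = 0)
  (q0 : forall x, x <= a -> q x = 0).

Lemma sl_system_exists h (y0 z0 : R) : integr h -> (forall x, x <= a -> h x = 0) ->
  exists y z, [/\ sl_system s r q h y z, y a = y0 & z a = z0].
Proof.
move=> hi h0.
have iN f : integr f -> integr (fun x => - f x).
  by move=> fi; under eq_fun do rewrite -mulN1r; exact: integrZ.
pose A (i j : bool) x := if i then (if j then s x else r x)
                         else (if j then - q x else - s x).
pose b (i : bool) x := if i then 0 else - h x.
pose c (i : bool) := if i then y0 else z0.
have [||||Y HY] := @linear_system_solution R _ A b a c.
- by move=> [] [] //=; exact: iN.
- by move=> [] [] x xa /=; rewrite ?s0 ?r0 ?q0 ?oppr0.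
- by case=> /=; [exact: integr0|exact: iN].
- by case=> x xa //=; rewrite h0 ?oppr0.
have [[pt Yt] [pf Yf]] := (HY true, HY false).
exists (Y true), (Y false); split=> //; split.
- by apply: eq_primitive pt => // x; rewrite /rhs big_bool/= addr0.
- apply: eq_primitive pf => // x; rewrite /rhs big_bool/= !mulNr.
  by rewrite [- _ - _]addrC.
Qed.

(** All the coefficients cancel because the matrix of the system has trace zero. *)
Lemma wronskian_primitive h y z u w :
  sl_system s r q h y z -> sl_system s r q (fun=> 0) u w ->
  primitive (fun x => y x * w x - z x * u x) (fun x => h x * u x).
Proof.
move=> [py pz] [pu pw].
have := primitiveD (primitive_mul py pw) (primitiveZ (-1) (primitive_mul pz pu)).
by apply: eq_primitive => x; ring.
Qed.

Lemma sl_systemD (c1 c2 : R) u1 w1 u2 w2 :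
  sl_system s r q (fun=> 0) u1 w1 -> sl_system s r q (fun=> 0) u2 w2 ->
  sl_system s r q (fun=> 0) (fun x => c1 * u1 x + c2 * u2 x)
    (fun x => c1 * w1 x + c2 * w2 x).
Proof.
move=> [pu1 pw1] [pu2 pw2]; split.
- have := primitiveD (primitiveZ c1 pu1) (primitiveZ c2 pu2).
  by apply: eq_primitive => x; ring.
- have := primitiveD (primitiveZ c1 pw1) (primitiveZ c2 pw2).
  by apply: eq_primitive => x; ring.
Qed.

Variable b : R.
Hypothesis ab : a < b.
Hypothesis r_neq0 : {ae mu, forall x, a < x < b -> r x != 0}.

(** A solution is detected by its first component: if u = 0 then
    0 = u' = r w with r nonzero almost everywhere, so w = 0. *)
Lemma unobservable_eq0 u w : sl_system s r q (fun=> 0) u w ->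
  \int[mu]_(x in `]a, b]) (u x * u x) = 0 -> u a = 0 /\ w a = 0.
Proof.
move=> [pu pw].
have cu := primitive_continuous pu; have cw := primitive_continuous pw.
have u_meas := primitive_measurable pu.
have [M bM] := primitive_bounded pu.
have iuu : mu.-integrable `]a, b] (EFin \o (fun x => u x * u x)).
  exact: (bounded_mul_integrable a b u_meas u_meas bM bM).
move=> uu0.
have {}uu0 : (\int[mu]_(x in `]a, b]) `|(u x * u x)%:E| = 0)%E.
  rewrite -[RHS]/(0%:E) -uu0 -[LHS]fineK; last first.
    by apply: integrable_fin_num => //; exact: integrable_abse iuu.
  congr (fine _)%:E; apply: eq_integral => x _ /=.
  by rewrite ger0_norm// -expr2 sqr_ge0.
have mE : measurable_fun (`]a, b]%classic : set (measurableTypeR R))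
    (fun x => (u x * u x)%:E) by exact: measurable_int iuu.
have {}uu0 : ae_eq mu `]a, b]%classic (fun x => (u x * u x)%:E) (cst 0%E).
  by apply/(ae_eq_integral_abs _ _ mE).
have u0 : forall x, a <= x <= b -> u x = 0.
  apply: (continuous_ae_eq0 cu ab); apply: ae_itv_oo.
  apply: aeS uu0 => x H /andP[ax xb]; have := H.
  by rewrite /= in_itv/= ax (ltW xb) => /(_ isT)/eqP; rewrite eqe mulf_eq0 orbb => /eqP.
have w0 : forall x, a <= x <= b -> w x = 0.
  apply: (continuous_ae_eq0 cw ab); apply: ae_itv_oo.
  apply: aeS2 (primitive_derive pu) r_neq0 => x [du eu] rx abx.
  have /andP[ax bx] := abx.
  have : derive1 u x = 0.
    have <- : derive1 (cst 0 : R -> R) x = 0 by rewrite derive1_cst.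
    rewrite !derive1E; apply: near_eq_derive => //.
    near=> t; apply: u0; apply/andP; split; apply/ltW; near: t.
      exact: lt_nbhsr.
    exact: lt_nbhsl.
  rewrite eu u0 ?(ltW ax) ?(ltW bx)// mulr0 add0r => /eqP.
  by rewrite mulf_eq0 (negbTE (rx abx)) => /eqP.
by rewrite u0 ?w0// lexx ltW.
Unshelve. all: by end_near. Qed.

(** The forcing is sought in the span of u1 and u2, cut off to ]a, b]; its two
    coefficients solve the Gram system that the Wronskian identity produces. *)
Lemma steering (ya za yb zb : R) : exists h y z,
  [/\ [/\ integr h, measurable_fun setT h & exists M, forall x, `|h x| <= M],
      sl_system s r q h y z, y a = ya /\ z a = za & y b = yb /\ z b = zb].
Proof.
have [u1 [w1 [sys1 u1a w1a]]] := @sl_system_exists (fun=> 0) 1 0 integr0 (fun _ _ => erefl).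
have [u2 [w2 [sys2 u2a w2a]]] := @sl_system_exists (fun=> 0) 0 1 integr0 (fun _ _ => erefl).
pose g (f f' : R -> R) := \int[mu]_(x in `]a, b]) (f x * f' x).
pose J : R -> R := (cst (1 : R)) \_ `]a, b].
have Ji : integr J.
  apply: integr_restrict => //; apply: (@bounded_integrable _ _ _ 1) => //.
  by move=> x; rewrite normr1.
have mJ := integr_measurable Ji.
have J_le1 x : `|J x| <= 1 by rewrite /J patchE; case: ifP; rewrite ?normr1 ?normr0.
have nice u w : sl_system s r q (fun=> 0) u w ->
    measurable_fun setT u /\ exists M, forall x, `|u x| <= M.
  by move=> [pu _]; split; [exact: primitive_measurable pu|exact: primitive_bounded pu].
have gi u w u' w' : sl_system s r q (fun=> 0) u w ->
    sl_system s r q (fun=> 0) u' w' ->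
    mu.-integrable `]a, b] (EFin \o (fun x => u x * u' x)).
  move=> /nice[mu1 [M bM]] /nice[mu2 [M' bM']].
  exact: (bounded_mul_integrable a b mu1 mu2 bM bM').
(* the square norm of c1 u1 + c2 u2 *)
pose G (c1 c2 : R) := c1 ^+ 2 * g u1 u1 + 2 * (c1 * c2) * g u1 u2 + c2 ^+ 2 * g u2 u2.
have G0 c1 c2 : G c1 c2 = 0 -> c1 = 0 /\ c2 = 0.
  move=> Gc; have sys := sl_systemD c1 c2 sys1 sys2.
  have [|] := unobservable_eq0 sys.
    rewrite -Gc /G /g -!RintegralZl//; try by [exact: (gi _ _ _ _ sys1 sys1)|exact: (gi _ _ _ _ sys1 sys2)|exact: (gi _ _ _ _ sys2 sys2)].
    have iZ c u w u' w' : sl_system s r q (fun=> 0) u w ->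
        sl_system s r q (fun=> 0) u' w' ->
        mu.-integrable `]a, b] (EFin \o (fun x => c * (u x * u' x))).
      by move=> H H'; exact: (integrableZl _ c (gi _ _ _ _ H H')).
    have i1 := iZ (c1 ^+ 2) _ _ _ _ sys1 sys1.
    have i2 := iZ (2 * (c1 * c2)) _ _ _ _ sys1 sys2.
    have i3 := iZ (c2 ^+ 2) _ _ _ _ sys2 sys2.
    rewrite -!RintegralD//; last exact: (integrableD _ i1 i2).
    by apply: eq_Rintegral => x _; ring.
  by rewrite u1a u2a w1a w2a !(mulr1, mulr0, addr0, add0r).
pose dt := g u1 u1 * g u2 u2 - g u1 u2 ^+ 2.
have dt0 : dt != 0.
  apply/eqP => dt0.
  have [g22 _] : g u2 u2 = 0 /\ - g u1 u2 = 0.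
    (* (g22, - g12) is in the kernel of a singular Gram matrix *)
    by apply: G0; rewrite /G -[RHS](mulr0 (g u2 u2)) -dt0 /dt; ring.
  have [_ /eqP] : (0 : R) = 0 /\ (1 : R) = 0 by apply: G0; rewrite /G g22; ring.
  by rewrite oner_eq0.
(* the increments that the two Wronskians must have *)
pose e1 := (yb * w1 b - zb * u1 b) - (ya * w1 a - za * u1 a).
pose e2 := (yb * w2 b - zb * u2 b) - (ya * w2 a - za * u2 a).
pose c1 := (e1 * g u2 u2 - e2 * g u1 u2) / dt.
pose c2 := (g u1 u1 * e2 - g u1 u2 * e1) / dt.
pose k x := c1 * u1 x + c2 * u2 x.
have sysk := sl_systemD c1 c2 sys1 sys2.
have [mk [M bk]] := nice _ _ sysk.
have hi : integr (fun x => J x * k x) by exact: integr_mul bk.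
have [x xa|y [z [sysy yaE zaE]]] := sl_system_exists ya za hi.
  rewrite /J patchE memNset ?mul0r//= in_itv/=.
  by move/andP => -[]; rewrite ltNge xa.
exists (fun x => J x * k x), y, z.
have W u w : sl_system s r q (fun=> 0) u w ->
    y b * w b - z b * u b = ya * w a - za * u a + (c1 * g u1 u + c2 * g u2 u).
  move=> sysu; have [_ /(_ _ _ (ltW ab))] := wronskian_primitive sysy sysu.
  rewrite yaE zaE => /eqP; rewrite subr_eq => /eqP ->; rewrite [LHS]addrC; congr (_ + _).
  have iu1 := gi _ _ _ _ sys1 sysu; have iu2 := gi _ _ _ _ sys2 sysu.
  rewrite /g -!RintegralZl// -RintegralD//; last 2 first.
  - exact: (integrableZl _ c1 iu1).
  - exact: (integrableZl _ c2 iu2).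
  apply: eq_Rintegral => x xab; rewrite /J patchE xab /= /k; ring.
have gC : g u2 u1 = g u1 u2 by apply: eq_Rintegral => x _; rewrite mulrC.
have W1 := W _ _ sys1; have W2 := W _ _ sys2.
have E1 : c1 * g u1 u1 + c2 * g u2 u1 = e1 by rewrite gC /c1 /c2 /dt; field.
have E2 : c1 * g u1 u2 + c2 * g u2 u2 = e2 by rewrite /c1 /c2 /dt; field.
have W12 : u1 b * w2 b - w1 b * u2 b = 1.
  have [_ /(_ _ _ (ltW ab))] := wronskian_primitive sys1 sys2.
  rewrite u1a u2a w1a w2a mul1r mulr0 subr0 => /eqP; rewrite subr_eq => /eqP ->.
  rewrite (@eq_Rintegral _ _ _ _ _ (cst 0)) ?Rintegral_cst ?mul0r ?add0r//.
  by move=> x _; rewrite mul0r.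
rewrite E1 /e1 in W1; rewrite E2 /e2 in W2.
have H1 : (y b - yb) * w1 b = (z b - zb) * u1 b by apply/eqP; rewrite -subr_eq0; apply/eqP; lra.
have H2 : (y b - yb) * w2 b = (z b - zb) * u2 b by apply/eqP; rewrite -subr_eq0; apply/eqP; lra.
split=> //.
- split=> //; first exact: measurable_funM.
  exists M => x; rewrite normrM; apply: le_trans (bk x).
  by rewrite -[leRHS]mul1r; apply: ler_wpM2r.
- split; apply/eqP; rewrite -subr_eq0; apply/eqP.
  + transitivity (u1 b * ((y b - yb) * w2 b) - ((y b - yb) * w1 b) * u2 b).
      by rewrite -[LHS]mulr1 -W12; ring.
    by rewrite H1 H2; ring.
  + transitivity (((z b - zb) * u1 b) * w2 b - w1 b * ((z b - zb) * u2 b)).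
      by rewrite -[LHS]mulr1 -W12; ring.
    by rewrite -H1 -H2; ring.
Qed.

End System.
End Steering.

(** * Absolutely continuous representatives *)

Section ACVersion.
Context {R : realType}.
Local Notation C := R[i].
Local Notation mu := (@lebesgue_measure R).
Implicit Types (a b x : R) (f g F G : R -> R) (y z h : R -> C).

Lemma normc_opp (u : C) : normc (- u) = normc u.
Proof. by case: u => u v; rewrite /= !sqrrN. Qed.

Lemma normc_le_add (u : C) : normc u <= `|Re u| + `|Im u|.
Proof.
rewrite -(ger0_norm (normc_ge0 u)) -[leRHS]ger0_norm ?addr_ge0//.
rewrite -ler_sqr ?nnegrE// !real_normK ?num_real// normc_sqr sqrrD !real_normK ?num_real//.
by rewrite addrAC lerDl mulrn_wge0// mulr_ge0.
Qed.

(** Absolute continuity of the integral, applied to the union of the disjoint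
    intervals. *)
Lemma primitive_AC a b F f G g : primitive F f -> primitive G g ->
  Defs.AC a b (fun x => Complex (F x) (G x)).
Proof.
move=> pF pG e e0.
pose n : R -> R := fun x => `|f x| + `|g x|.
have ni : integr n by apply: integrD; apply: integr_abs; [exact: pF.1|exact: pG.1].
have [d [d0 H]] := integral_normr_continuous ni e0.
exists d => // k s t hst disj sumd.
pose E (i : 'I_k) : set (measurableTypeR R) := `]s i, t i]%classic.
have mE i : measurable (E i) by exact: measurable_itv.
have tE : trivIset setT E.
  apply/trivIsetP => i j _ _ ij; apply/seteqP; split=> // x [].
  rewrite /E /= !in_itv/= => /andP[sx xt] /andP[sx' xt'].
  have [h|h] := disj i j ij; first by have := le_lt_trans (le_trans xt h) sx'; rewrite ltxx.
  by have := le_lt_trans (le_trans xt' h) sx; rewrite ltxx.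
pose D := \big[setU/set0]_(i < k) E i.
have mD : measurable D by exact: bigsetU_measurable.
have muD : (mu D < d%:E)%E.
  rewrite (measure_bigsetU_ord _ xpredT mE tE).
  rewrite (eq_bigr (fun i => (t i - s i)%:E)) ?sumEFin ?lte_fin//.
  move=> i _; rewrite [LHS]lebesgue_measure_itv/= lte_fin; case: ltP => //.
  by have [_ st _] := hst i => ts; rewrite (@le_anti _ _ (t i) (s i)) ?subrr// ts st.
apply: le_lt_trans (H D mD muD).
have -> : \int[mu]_(x in D) `|n x| = \sum_(i < k) \int[mu]_(x in E i) n x.
  apply: EFin_inj; rewrite -sumEFin.
  rewrite (eq_bigr (fun i => \int[mu]_(x in E i) (n x)%:E)%E); last first.
    by move=> i _; rewrite fineK//; apply: integrable_fin_num => //; exact: (integrS ni (mE i)).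
  rewrite -(@integral_bigsetU_EFin _ _ _ mu 'I_k E n) ?index_enum_uniq//.
  - rewrite fineK.
      by apply: eq_integral => x _; rewrite ger0_norm// /n addr_ge0.
    by apply: integrable_fin_num => //; exact: (integrS (integr_abs ni) mD).
  - exact: sub_trivIset tE.
  - by apply/measurable_EFinP; apply: measurable_funS (integr_measurable ni).
apply: ler_sum => i _; have [_ st _] := hst i.
apply: le_trans (normc_le_add _) _ => /=.
rewrite RintegralD//.
- by rewrite lerD//; exact: primitive_dist.
- exact: (integrS (integr_abs pF.1) (mE i)).
- exact: (integrS (integr_abs pG.1) (mE i)).
Qed.

Lemma AC_unif_cont a b y e : Defs.AC a b y -> 0 < e -> exists2 d, 0 < d &
  forall s t, a <= s <= b -> a <= t <= b -> `|t - s| < d -> normc (y t - y s) < e.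
Proof.
move=> ACy e0; have [d d0 H] := ACy e e0; exists d => // s t.
wlog st : s t / s <= t => [hw sab tab|].
  have [/hw|/ltW/hw] := leP s t; first exact.
  by rewrite distrC -[y t - y s]opprB normc_opp; exact.
move=> /andP[as_ sb] /andP[at_ tb]; rewrite ger0_norm ?subr_ge0// => std.
have := H 1%N (fun=> s) (fun=> t); rewrite !big_ord1; apply=> //.
by move=> i j; rewrite !ord1.
Qed.

Lemma AC_ae_eq a b y z : a < b -> Defs.AC a b y -> Defs.AC a b z ->
  ae_eq mu `[a, b]%classic y z -> forall x, a <= x <= b -> y x = z x.
Proof.
move=> ab ACy ACz yz x xab.
apply/eqP; rewrite -subr_eq0; apply/eqP/ComplexField.Normc.eq0_normc.
apply/eqP; rewrite eq_le normc_ge0 andbT; apply/ler_addgt0Pr => e e0; rewrite add0r.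
have e2 : 0 < e / 2 by rewrite divr_gt0.
have [d d0 Hd] := AC_unif_cont ACy e2; have [d' d0' Hd'] := AC_unif_cont ACz e2.
have dd' : 0 < Num.min d d' by rewrite lt_min d0.
have [t [tab]] := ae_itv_near ab dd' yz xab.
rewrite lt_min => /andP[/(Hd _ _ tab xab) k1 /(Hd' _ _ tab xab) k2] yzt.
have -> : y x - z x = (y x - y t) + - (z x - z t) by rewrite yzt; ring.
apply: le_trans (le_normcD _ _) _.
by rewrite normc_opp; lra.
Qed.

Lemma ac_versionP a b h : has_ac_version a b h ->
  Defs.AC a b (ac_version a b h) /\ ae_eq mu `[a, b]%classic (ac_version a b h) h.
Proof.
move=> [y ACy yh]; rewrite /ac_version; case: xgetP => [z _ //|/(_ y)].
by move=> /(_ (conj ACy yh)).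
Qed.

Lemma ae_eq_sym_itv a b y z : ae_eq mu `[a, b]%classic y z ->
  ae_eq mu `[a, b]%classic z y.
Proof. by apply: aeS => x H /H. Qed.

Lemma ae_eq_trans_itv a b y z h : ae_eq mu `[a, b]%classic y z ->
  ae_eq mu `[a, b]%classic z h -> ae_eq mu `[a, b]%classic y h.
Proof. by apply: aeS2 => x H H' Dx; rewrite H ?H'. Qed.

Lemma ac_version_eq a b y h : a < b -> Defs.AC a b y ->
  ae_eq mu `[a, b]%classic y h ->
  forall x, a <= x <= b -> ac_version a b h x = y x.
Proof.
move=> ab ACy yh; have [ACh hh] := @ac_versionP a b h (ex_intro2 _ _ y ACy yh).
by apply: AC_ae_eq => //; apply: ae_eq_trans_itv hh (ae_eq_sym_itv yh).
Qed.

Lemma cderive_eq a b y z x : (forall t, a <= t <= b -> y t = z t) ->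
  a < x < b -> cderive y x = cderive z x.
Proof.
move=> yz /andP[ax xb]; rewrite /cderive !derive1E.
have near_eq : \forall t \near x, y t = z t.
  near=> t; apply: yz; apply/andP; split; apply/ltW; near: t.
    exact: lt_nbhsr.
  exact: lt_nbhsl.
by congr Complex; apply: near_eq_derive; apply: filterS near_eq => t /= ->.
Unshelve. all: by end_near. Qed.

(** * Complex conjugation *)

Definition conjf y : R -> C := fun x => (y x)^*.

Lemma AC_conj a b y : Defs.AC a b y -> Defs.AC a b (conjf y).
Proof.
move=> ACy e e0; have [d d0 H] := ACy e e0; exists d => // n s t hst disj sumd.
apply: le_lt_trans (H n s t hst disj sumd); apply: ler_sum => i _.
by rewrite -rmorphB normc_conj.
Qed.

Lemma ae_eq_conj a b y z : ae_eq mu `[a, b]%classic y z ->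
  ae_eq mu `[a, b]%classic (conjf y) (conjf z).
Proof. by apply: aeS => x H Dx; rewrite /conjf H. Qed.

(** Holds also where f has no derivative: both sides are then the default value 0. *)
Lemma derive1N_total f x : derive1 (\- f) x = - derive1 f x.
Proof.
have [df|ndf] := pselect (derivable f x 1).
  by rewrite !derive1E deriveN.
have ndNf : ~ derivable (\- f) x 1.
  by move=> /derivableN; rewrite (_ : - _ = f)//; apply/funext => t /=; rewrite opprK.
by rewrite !derive1E /derive (dvgP ndf) (dvgP ndNf) oppr0.
Qed.

Lemma cderive_conj y x : cderive (conjf y) x = (cderive y x)^*.
Proof.
rewrite /cderive conjCE /=; congr Complex.
  by congr derive1; apply/funext => t /=; rewrite Re_conjC.
by rewrite -derive1N_total; congr derive1; apply/funext => t /=; rewrite Im_conjC.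
Qed.

Lemma has_ac_version_conj a b y z : ae_eq mu `[a, b]%classic z (conjf y) ->
  has_ac_version a b y -> has_ac_version a b z.
Proof.
move=> zy [u ACu uy]; exists (conjf u); first exact: AC_conj.
exact: ae_eq_trans_itv (ae_eq_conj uy) (ae_eq_sym_itv zy).
Qed.

Lemma ac_version_conj a b y z : a < b -> ae_eq mu `[a, b]%classic z (conjf y) ->
  has_ac_version a b y ->
  forall x, a <= x <= b -> ac_version a b z x = (ac_version a b y x)^*.
Proof.
move=> ab zy /ac_versionP[ACy yy]; apply: (ac_version_eq ab (AC_conj ACy)).
exact: ae_eq_trans_itv (ae_eq_conj yy) (ae_eq_sym_itv zy).
Qed.

Section OneInterval.
Variables (a b : R) (p Q : R -> R).
Hypothesis ab : a < b.
Lemma D0_conj (f : L2 a b) : has_ac_version a b (repr f) ->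
  forall x, a <= x <= b -> D0 (L2conj f) x = (D0 f x)^*.
Proof. exact: ac_version_conj (L2conj_ae f). Qed.

Lemma conjC_real (r : R) : (r%:C%C : C)^* = r%:C%C.
Proof. by rewrite conjCE /= oppr0. Qed.

Lemma pD1_conj (f : L2 a b) : has_ac_version a b (repr f) ->
  ae_eq mu `[a, b]%classic (pD1 p Q (L2conj f)) (conjf (pD1 p Q f)).
Proof.
move=> hf; apply: ae_itv_oo; apply: aeW => x xab; rewrite /pD1 /conjf.
rewrite rmorphB !rmorphM /= !conjC_real -cderive_conj -D0_conj//; last first.
  by case/andP: xab => *; rewrite !ltW.
by congr (_ * _ - _); apply: (@cderive_eq a b) => //; exact: D0_conj.
Qed.

Lemma D1_conj (f : L2 a b) : has_ac_version a b (repr f) -> has_ac_version a b (pD1 p Q f) ->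
  forall x, a <= x <= b -> D1 p Q (L2conj f) x = (D1 p Q f x)^*.
Proof. by move=> hf; apply: ac_version_conj => //; exact: pD1_conj. Qed.

Lemma D2_conj (f : L2 a b) : has_ac_version a b (repr f) -> has_ac_version a b (pD1 p Q f) ->
  forall x, a < x < b -> D2 p Q (L2conj f) x = (D2 p Q f x)^*.
Proof.
move=> hf hf1 x xab; have xab' : a <= x <= b by case/andP: xab => *; rewrite !ltW.
rewrite /D2 !rmorphD !rmorphM /= !conjC_real -cderive_conj.
rewrite -D0_conj// -D1_conj//; congr (_ + _ + _).
by apply: (@cderive_eq a b) => //; exact: D1_conj.
Qed.

Lemma Lmax1_conj (f g : L2 a b) : Lmax1 p Q (f, g) -> Lmax1 p Q (L2conj f, L2conj g).
Proof.
move=> [/= hf hf1 fg]; split => /=.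
- exact: has_ac_version_conj (L2conj_ae f) hf.
- exact: has_ac_version_conj (pD1_conj hf) hf1.
apply: ae_eq_trans_itv (L2conj_ae g) _; apply: ae_itv_oo.
apply: aeS fg => x H xab; rewrite D2_conj// -rmorphN -H//=.
by case/andP: xab => ax xb; rewrite in_itv/= !ltW.
Qed.

End OneInterval.

End ACVersion.

(** * Boundary values on one interval are arbitrary *)

Section OneIntervalSurjective.
Context {R : realType}.
Local Notation C := R[i].
Local Notation mu := (@lebesgue_measure R).
Implicit Types (x : R).

Lemma bounded_sqint (a b M M' : R) (f g : R -> R) :
  measurable_fun setT f -> measurable_fun setT g ->
  (forall x, `|f x| <= M) -> (forall x, `|g x| <= M') ->
  (fun x => Complex (f x) (g x)) \in sqint a b.
Proof.
move=> mf mg bf bg; apply/asboolP; split.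
- exact: measurable_funS mf.
- exact: measurable_funS mg.
apply: measurable_bounded_integrable => //.
- have : (mu `[a, b]%classic < +oo)%E.
    by rewrite lebesgue_measure_itv/= lte_fin; case: ifP => _; rewrite ltry.
  exact.
- apply: measurable_normc2; [exact: measurable_funS mf|exact: measurable_funS mg].
exists (M ^+ 2 + M' ^+ 2); split => [|m Mm]; first exact: num_real.
move=> x _; rewrite /= sqr_sqrtr ?addr_ge0 ?sqr_ge0//.
rewrite ger0_norm ?addr_ge0 ?sqr_ge0// (le_trans _ (ltW Mm))//.
rewrite -[f x ^+ 2]real_normK ?num_real// -[g x ^+ 2]real_normK ?num_real//.
have M0 := le_trans (normr_ge0 _) (bf x); have M'0 := le_trans (normr_ge0 _) (bg x).
by apply: lerD; apply: lerXn2r; rewrite ?nnegrE.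
Qed.

(** Extension by zero, on the whole line and with a Borel representative, makes the
    coefficients fit for [linear_system_solution]. *)
Lemma L1_extension (a b : R) (h : R -> R) : L1 a b h -> exists g,
  [/\ integr g, forall x, x <= a -> g x = 0 &
      {ae mu, forall x, a < x < b -> g x = h x}].
Proof.
move=> [g gi hg]; exists (g \_ `]a, b]); split.
- apply: integr_restrict => //; apply: integrableS gi => //.
  by apply: subset_itvr; rewrite bnd_simp.
- move=> x xa; rewrite patchE memNset//= in_itv/=.
  by move/andP => -[]; rewrite ltNge xa.
apply: aeS hg => x H /andP[ax xb]; rewrite patchE mem_set/= ?in_itv/= ?ax ?ltW//.
by rewrite H//= in_itv/= !ltW.
Qed.

Lemma cderive_primitive f f' g g' : primitive f f' -> primitive g g' ->
  {ae mu, forall x, cderive (fun t => Complex (f t) (g t) : C) x =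
                    Complex (f' x) (g' x)}.
Proof.
move=> /primitive_derive fd /primitive_derive gd.
by apply: aeS2 fd gd => x [_ <-] [_ <-].
Qed.

(** The real and imaginary parts are steered separately, the coefficients being
    real. *)
Lemma Lmax1_surjective (a b : R) (p Q : R -> R) (ya za yb zb : C) :
  a < b -> admissible a b p Q -> exists f g : L2 a b,
  [/\ Lmax1 p Q (f, g), D0 f a = ya /\ D1 p Q f a = za &
      D0 f b = yb /\ D1 p Q f b = zb].
Proof.
move=> ab [_ p0 /L1_extension[r [ri r0 rE]] /L1_extension[s [si s0 sE]]
  /L1_extension[q [qi q0 qE]]].
have aab : a <= a <= b by rewrite lexx ltW.
have bab : a <= b <= b by rewrite lexx ltW.
have r_neq0 : {ae mu, forall x, a < x < b -> r x != 0}.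
  apply: aeS2 p0 rE => x px rx xab; rewrite rx// mul1r invr_eq0 px//=.
  by case/andP: xab => ax xb; rewrite in_itv/= !ltW.
have st := steering si ri qi s0 r0 q0 ab r_neq0.
have [h1 [y1 [z1 [[h1i mh1 [M1 bh1]] [py1 pz1] [y1a z1a] [y1b z1b]]]]] :=
  st (Re ya) (Re za) (Re yb) (Re zb).
have [h2 [y2 [z2 [[h2i mh2 [M2 bh2]] [py2 pz2] [y2a z2a] [y2b z2b]]]]] :=
  st (Im ya) (Im za) (Im yb) (Im zb).
pose Y x : C := Complex (y1 x) (y2 x).
pose Z x : C := Complex (z1 x) (z2 x).
pose G x : C := Complex (h1 x) (h2 x).
have [B1 by1] := primitive_bounded py1; have [B2 by2] := primitive_bounded py2.
have sqY : Y \in sqint a b.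
  exact: (bounded_sqint a b (primitive_measurable py1) (primitive_measurable py2) by1 by2).
have sqG : G \in sqint a b by exact: (bounded_sqint a b mh1 mh2 bh1 bh2).
have ACY : Defs.AC a b Y by exact: (primitive_AC a b py1 py2).
have ACZ : Defs.AC a b Z by exact: (primitive_AC a b pz1 pz2).
pose f := L2class a b Y; pose g := L2class a b G.
have fY : ae_eq mu `[a, b]%classic Y (repr f : R -> C).
  exact/ae_eq_sym_itv/(L2class_ae sqY).
have D0f : forall x, a <= x <= b -> D0 f x = Y x by exact: ac_version_eq ACY fY.
have coef : {ae mu, forall x, a < x < b ->
    [/\ p x != 0, r x = 1 / p x, s x = Q x / p x & q x = Q x ^+ 2 / p x]}.
  have pr : {ae mu, forall x, a < x < b -> p x != 0 /\ r x = 1 / p x}.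
    apply: aeS2 p0 rE => x px rx xab; split; last exact: rx.
    by apply: px; case/andP: xab => ax xb; rewrite /= in_itv/= !ltW.
  apply: aeS3 pr sE qE => x prx sx qx xab.
  by have [px rx] := prx xab; split; [|rewrite rx|rewrite sx|rewrite qx].
have oo_cc x : a < x < b -> a <= x <= b by case/andP => *; rewrite !ltW.
have pD1f : ae_eq mu `[a, b]%classic Z (pD1 p Q f).
  apply: ae_itv_oo; apply: aeS2 coef (cderive_primitive py1 py2) => x cx dx xab.
  have [px rx sx _] := cx xab.
  rewrite /pD1 D0f ?oo_cc// (cderive_eq D0f xab) dx rx sx.
  by apply/eqP; rewrite eq_complex /=; apply/andP; split; apply/eqP; field.
have D1f : forall x, a <= x <= b -> D1 p Q f x = Z x by exact: ac_version_eq ACZ pD1f.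
exists f, g; split.
- split=> /=; [by exists Y|by exists Z|].
  apply: ae_eq_trans_itv (L2class_ae sqG) _; apply: ae_itv_oo.
  apply: aeS2 coef (cderive_primitive pz1 pz2) => x cx dx xab.
  have [px rx sx qx] := cx xab.
  rewrite /D2 D0f ?D1f ?oo_cc// (cderive_eq D1f xab) dx sx qx.
  by apply/eqP; rewrite eq_complex /=; apply/andP; split; apply/eqP; field.
- by rewrite D0f ?D1f// /Y /Z y1a y2a z1a z2a; case: (ya) (za) => ? ? [].
- by rewrite D0f ?D1f// /Y /Z y1b y2b z1b z2b; case: (yb) (zb) => ? ? [].
Qed.

End OneIntervalSurjective.

(** * Assembling the intervals *)

Section Pieces.
Context {R : realType} (m : nat) (a : nat -> R) (p Q : 'I_m -> R -> R).
Local Notation C := R[i].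
Local Notation mu := (@lebesgue_measure R).
Local Notation H := (L2 (a 0%N) (a m)).
Hypothesis m_gt0 : (0 < m)%N.
Hypothesis a_incr : forall i : 'I_m, a i < a i.+1.
Implicit Types (x y f g : H) (i : 'I_m).

Lemma a_homo (j k : nat) : (j <= k)%N -> (k <= m)%N -> a j <= a k.
Proof.
elim: k => [|k IH]; first by rewrite leqn0 => /eqP ->.
rewrite leq_eqVlt ltnS => /predU1P[->//|jk] km.
exact: le_trans (IH jk (ltnW km)) (ltW (a_incr (Ordinal km))).
Qed.

Lemma partition_cover (k : nat) (t : R) : (0 < k <= m)%N -> a 0%N <= t <= a k ->
  exists2 i : 'I_m, (i < k)%N & a i <= t <= a i.+1.
Proof.
elim: k => // k IH /= km /andP[t0 tk].
have [ak|kt] := leP (a k) t; first by exists (Ordinal km) => //=; rewrite ak.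
case: k => [|k] in IH km tk kt *; first by rewrite leNgt kt in t0.
have [||i ik it] := IH; [exact: ltnW|by rewrite t0 ltW|].
by exists i => //; exact: ltnW.
Qed.

Lemma piece_ae i x :
  ae_eq mu `[a i, a i.+1]%classic (repr (piece i x) : R -> C) (repr x : R -> C).
Proof. by apply: L2restr_ae; apply: a_homo => //; exact: ltnW. Qed.

Lemma piece_conj i x : piece i (L2conj x) = L2conj (piece i x).
Proof.
apply: L2_eq_ae.
have sub t : `[a i, a i.+1]%classic t -> `[a 0%N, a m]%classic t.
  rewrite /= !in_itv/= => /andP[h1 h2]; apply/andP; split.
    by apply: le_trans h1; apply: a_homo => //; exact: ltnW.
  by apply: le_trans h2 _; exact: a_homo.
apply: ae_eq_trans_itv (piece_ae i (L2conj x)) _.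
apply: (ae_eq_trans_itv _ (ae_eq_sym_itv (L2conj_ae (piece i x)))).
apply: aeS2 (L2conj_ae x) (piece_ae i x) => t e1 e2 Dt.
by rewrite e1 ?e2//; exact: sub.
Qed.

Lemma piece_inj x y : (forall i, piece i x = piece i y) -> x = y.
Proof.
move=> xy; apply: L2_eq_ae.
have H : {ae mu, forall t, forall i, `[a i, a i.+1]%classic t ->
    (repr x : R -> C) t = (repr y : R -> C) t}.
  apply: (@filter_forall _ _ _ _ (ae_filter_ringOfSetsType mu)) => i.
  have := ae_eq_trans_itv (ae_eq_sym_itv (piece_ae i x)).
  by apply; rewrite xy; exact: piece_ae.
apply: aeS H => t H; rewrite /= in_itv/= => /(partition_cover (k := m)).
by rewrite m_gt0 leqnn => /(_ isT)[i _ it]; apply: (H i); rewrite /= in_itv.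
Qed.

Lemma sqint_patch (c d e e' : R) (h : R -> C) : c <= e -> e' <= d ->
  h \in sqint e e' -> (fun t => if e < t < e' then h t else 0) \in sqint c d.
Proof.
move=> ce de /asboolP[hr hi h2].
pose D := `]e, e'[%classic : set R.
have sub : D `<=` `[e, e'].
  by move=> t; rewrite /D /= !in_itv/= => /andP[? ?]; rewrite !ltW.
have patchm (f : R -> R) : measurable_fun `[e, e'] f -> measurable_fun `[c, d] (f \_ D).
  move=> mf; have mD : measurable D by exact: measurable_itv.
  have /(measurable_restrictT f mD) : measurable_fun D f.
    exact: (measurable_funS (measurable_itv _) sub mf).
  exact: measurable_funTS.
have eP (f : C -> R) : f 0 = 0 ->
    f \o (fun t => if e < t < e' then h t else 0) = (f \o h) \_ D.
  move=> f0; apply/funext => t /=; rewrite patchE; case: ifPn => tD.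
    by rewrite mem_set// /D /= in_itv.
  by rewrite memNset// /D /= in_itv/=; exact/negP.
apply/asboolP; split.
- by rewrite (eP Re)//; exact: patchm.
- by rewrite (eP Im)//; exact: patchm.
rewrite (_ : EFin \o _ = EFin \o ((fun t => normc (h t) ^+ 2) \_ D)).
  have mD : measurable D by exact: measurable_itv.
  have i2 : integr ((fun t => normc (h t) ^+ 2) \_ D).
    apply: integr_restrict; first exact: measurable_itv.
    by apply: (@integrableS _ (measurableTypeR R) _ _ `[e, e'] D); try exact: measurable_itv.
  exact: (integrS i2 (measurable_itv _)).
congr (EFin \o _); apply: (eP (fun u => normc u ^+ 2)).
by rewrite ComplexField.Normc.normc0 expr0n.
Qed.

(** Cutting off to the open intervals makes the pieces disjoint; the partition
    points form a null set. *)
Lemma piece_surj (u : forall i, L2 (a i) (a i.+1)) : exists x, forall i, piece i x = u i.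
Proof.
pose h (i : 'I_m) t : C := if a i < t < a i.+1 then repr (u i) t else 0.
have hs i : h i \in sqint (a 0%N) (a m).
  apply: sqint_patch; [|exact: a_homo|exact: L2funP].
  by apply: a_homo => //; exact: ltnW.
have hS : \sum_i h i \in sqint (a 0%N) (a m) by exact: rpred_sum.
exists (L2class (a 0%N) (a m) (\sum_i h i)) => i; apply: L2_eq_ae.
apply: ae_eq_trans_itv (piece_ae i _) _; apply: ae_itv_oo.
apply: aeS (L2class_ae hS) => t e /andP[t1 t2].
have i0 : a 0%N <= a i by apply: a_homo => //; exact: ltnW.
have im : a i.+1 <= a m by exact: a_homo.
rewrite e/=; last first.
  by rewrite in_itv/= (le_trans i0 (ltW t1)) (le_trans (ltW t2) im).
rewrite fct_sumE (bigD1 i)//= big1 ?addr0 /h ?t1 ?t2// => j ji.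
case: ifP => // /andP[s1 s2].
have [ij|ji'|/val_inj e'] := ltngtP i j; last by rewrite e' eqxx in ji.
- by have := lt_le_trans t2 (a_homo ij (ltnW (ltn_ord j))); rewrite ltNge (ltW s1).
- by have := lt_le_trans s2 (a_homo ji' (ltnW (ltn_ord i))); rewrite ltNge (ltW t1).
Qed.

(** * Conjugation and the boundary maps *)

Local Notation Lmx := (Lmax a p Q).
Local Notation G1 := (Gamma1 a p Q).
Local Notation G2 := (Gamma2 a).
Local Notation "M ^conj" := (map_mx Num.conj M) (at level 2, format "M ^conj").

Lemma Lmax_conj f g : Lmx (f, g) -> Lmx (L2conj f, L2conj g).
Proof. by move=> fg i; rewrite /= !piece_conj; exact/Lmax1_conj/fg. Qed.

Lemma Lmax_fun f g g' : Lmx (f, g) -> Lmx (f, g') -> g = g'.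
Proof.
move=> fg fg'; apply: piece_inj => i; apply: L2_eq_ae.
have [_ _ /= h] := fg i; have [_ _ /= h'] := fg' i.
exact: ae_eq_trans_itv h (ae_eq_sym_itv h').
Qed.

Lemma Gamma2_conj f g : Lmx (f, g) -> G2 (L2conj f) = (G2 f)^conj.
Proof.
move=> fg; rewrite /Gamma2 -map_trmx map_mxvec; congr (mxvec _)^T.
apply/matrixP => i j; rewrite !mxE; have [/= h _ _] := fg i.
by case: ifP => _; rewrite piece_conj D0_conj// lexx ltW.
Qed.

Lemma Gamma1_conj f g : Lmx (f, g) -> G1 (L2conj f) = (G1 f)^conj.
Proof.
move=> fg; rewrite /Gamma1 -map_trmx map_mxvec; congr (mxvec _)^T.
apply/matrixP => i j; rewrite !mxE; have [/= h h1 _] := fg i.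
have e t : a i <= t <= a i.+1 ->
    D1 (p i) (Q i) (piece i (L2conj f)) t = (D1 (p i) (Q i) (piece i f) t)^*.
  by rewrite piece_conj; exact: D1_conj.
have ai := ltW (a_incr i).
have ea : a i <= a i <= a i.+1 by rewrite lexx.
have eb : a i <= a i.+1 <= a i.+1 by rewrite lexx andbT.
have e2 := e _ ea; have e1 := e _ eb; case: (j == 0); first exact: e2.
by rewrite [RHS]rmorphN; congr (- _); exact: e1.
Qed.

Hypothesis pQ_adm : forall i : 'I_m, admissible (a i) (a i.+1) (p i) (Q i).

Lemma Gamma_surjective (u v : 'cV[C]_(m * 2)) :
  exists f g, [/\ Lmx (f, g), G1 f = u & G2 f = v].
Proof.
pose U := vec_mx u^T; pose V := vec_mx v^T.
have ex i : exists fg : L2 (a i) (a i.+1) * L2 (a i) (a i.+1),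
    [/\ Lmax1 (p i) (Q i) fg,
        D0 fg.1 (a i) = V i 0 /\ D1 (p i) (Q i) fg.1 (a i) = U i 0 &
        D0 fg.1 (a i.+1) = V i 1 /\ D1 (p i) (Q i) fg.1 (a i.+1) = - U i 1].
  have [f [g fg]] := Lmax1_surjective (V i 0) (U i 0) (V i 1) (- U i 1)
    (a_incr i) (pQ_adm i).
  by exists (f, g).
pose F i := sval (cid (ex i)).
have FP i := svalP (cid (ex i)).
have [f fE] := piece_surj (fun i => (F i).1).
have [g gE] := piece_surj (fun i => (F i).2).
have j1 (j : 'I_2) : j != 0 -> j = 1 by case: j => [[|[|//]]] jP // _; exact/val_inj.
exists f, g; split.
- by move=> i; rewrite /= fE gE -surjective_pairing; have [] := FP i.
- rewrite -[RHS]trmxK -[u^T]vec_mxK; congr (mxvec _)^T.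
  apply/matrixP => i j; rewrite [LHS]mxE fE.
  have [_ [_ e0] [_ e1]] := FP i; rewrite -/(F i) in e0 e1.
  have [->|/j1 ->] := eqVneq j 0; first exact: e0.
  by rewrite e1 opprK.
- rewrite -[RHS]trmxK -[v^T]vec_mxK; congr (mxvec _)^T.
  apply/matrixP => i j; rewrite [LHS]mxE fE.
  have [_ [e0 _] [e1 _]] := FP i; rewrite -/(F i) in e0 e1.
  have [->|/j1 ->] := eqVneq j 0; first exact: e0.
  exact: e1.
Qed.

(** * Real boundary conditions *)

(** K^* is the inverse of K, and it equals conj K exactly when K is symmetric. *)
Lemma mulmx_conj_unitary (n : nat) (K : 'M[C]_n) : K \is unitarymx ->
  (K^conj *m K = 1%:M <-> K = K^T).
Proof.
move=> /unitarymxP KKs; have KsK := mulmx1C KKs; split=> h.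
  have e : K^conj = K^T^conj.
    by rewrite -[LHS]mulmx1 -KKs mulmxA h mul1mx.
  apply/matrixP => i j; have := congr1 (fun M : 'M[C]_n => (M i j)^*) e.
  by rewrite !mxE !conjCK.
by rewrite {1}h.
Qed.

(** The two families of boundary conditions are the cases c = 'i and c = - 'i. *)
Lemma real_boundary_condition (c : C) (K : 'M[C]_(m * 2)) :
  c^* = - c -> c * c = -1 -> K \is unitarymx ->
  real_operator [set fg : H * H | Lmx fg /\
    (K - 1%:M) *m G1 fg.1 + c *: ((K + 1%:M) *m G2 fg.1) = 0] <-> K = K^T.
Proof.
move=> cc c2 /mulmx_conj_unitary KE.
pose bc (u v : 'cV[C]_(m * 2)) := (K - 1%:M) *m u + c *: ((K + 1%:M) *m v).
(* the condition on the conjugates of u and v, conjugated *)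
pose bc' (u v : 'cV[C]_(m * 2)) :=
  (K^conj - 1%:M) *m u - c *: ((K^conj + 1%:M) *m v).
have bc'E u v : bc u^conj v^conj = (bc' u v)^conj.
  rewrite /bc /bc' map_mxB map_mxZ !map_mxM map_mxB map_mxD map_mx1.
  have -> : K^conj^conj = K by apply/matrixP => i j; rewrite !mxE conjCK.
  by rewrite /= cc scaleNr opprK.
have conj0 (u : 'cV[C]_(m * 2)) : u^conj = 0 <-> u = 0.
  split=> [/matrixP h|->]; last by rewrite map_mx0.
  by apply/matrixP => i j; have := h i j; rewrite !mxE => /eqP; rewrite conjC_eq0 => /eqP.
rewrite -KE; split=> [[Ldom _]|KK]; last first.
  have bc'0 u v : bc u v = 0 -> bc' u v = 0.
    move=> /(congr1 (mulmx K^conj)).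
    rewrite mulmx0 mulmxDr -scalemxAr !mulmxA mulmxBr mulmxDr KK !mulmx1.
    move=> e; rewrite -[RHS]oppr0 -[in RHS]e opprD -mulNmx opprB.
    by rewrite [1%:M + _]addrC.
  split=> [f [g [/= fg bc0]]|f g g' [/= fg _] [/= fg' _]]; last first.
    exact: Lmax_fun fg' (Lmax_conj fg).
  exists (L2conj g); split=> /=; first exact: Lmax_conj.
  rewrite (Gamma1_conj fg) (Gamma2_conj fg); apply: etrans (bc'E _ _) _.
  by rewrite bc'0// map_mx0.
have comm : (K - 1%:M) *m (K + 1%:M) = (K + 1%:M) *m (K - 1%:M).
  rewrite mulmxBl mulmxDl !mulmxDr !mulmxN !mul1mx !mulmx1.
  move: (K *m K) => X; apply/matrixP => i j; rewrite !mxE; ring.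
(* u = (K + 1) w, v = c (K - 1) w solve the boundary condition *)
have H0 (w : 'cV[C]_(m * 2)) : (K^conj *m K - 1%:M) *m w = 0.
  have [f [g [fg fu fv]]] :=
    Gamma_surjective ((K + 1%:M) *m w) (c *: ((K - 1%:M) *m w)).
  have [|g' [/= fg' bc0]] := Ldom f.
    exists g; split=> //=; rewrite fu fv -scalemxAr scalerA c2 scaleN1r !mulmxA.
    by rewrite comm subrr.
  move: bc0; rewrite (Gamma1_conj fg) (Gamma2_conj fg) => bc0.
  have {}bc0 : bc' (G1 f) (G2 f) = 0 by apply/conj0; rewrite -bc'E.
  move: bc0; rewrite /bc' fu fv -scalemxAr scalerA c2 scaleN1r opprK !mulmxA -mulmxDl.
  rewrite (_ : _ + _ = (K^conj *m K - 1%:M) *+ 2); last first.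
    rewrite mulmxBl mulmxDl !mulmxDr !mulmxN !mul1mx !mulmx1 mulr2n.
    move: (K^conj *m K) (K^conj) => X Y; apply/matrixP => i j; rewrite !mxE; ring.
  rewrite -scaler_nat -scalemxAl => /eqP.
  by rewrite scaler_eq0 pnatr_eq0 => /eqP.
apply/eqP; rewrite -subr_eq0; apply/eqP/matrixP => i j.
by have /colP/(_ i) := H0 (delta_mx j 0); rewrite -colE !mxE.
Qed.

Theorem real_L_sub (K : 'M[C]_(m * 2)) : K \is unitarymx ->
  real_operator (L_sub a p Q K) <-> K = K^T.
Proof. by apply: real_boundary_condition; [exact: conjCi|rewrite -expr2 sqrCi]. Qed.

Theorem real_L_sup (K : 'M[C]_(m * 2)) : K \is unitarymx ->
  real_operator (L_sup a p Q K) <-> K = K^T.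
Proof.
have -> : L_sup a p Q K = [set fg : H * H | Lmx fg /\
    (K - 1%:M) *m G1 fg.1 + (- 'i) *: ((K + 1%:M) *m G2 fg.1) = 0].
  by apply/seteqP; split=> fg /=; rewrite scaleNr.
apply: real_boundary_condition; first by rewrite rmorphN /= conjCi.
by rewrite mulrNN -expr2 sqrCi.
Qed.

End Pieces.

Local Open Scope ring_scope.

Theorem theorem3 (R : realType) (m : nat) (a : nat -> R)
    (p Q : 'I_m -> R -> R)
    (m_gt0 : (0 < m)%N)
    (a_incr : forall i : 'I_m, a i < a i.+1)
    (pQ_adm : forall i : 'I_m, admissible (a i) (a i.+1) (p i) (Q i)) :
  (forall T : operator (a 0%N) (a m),
     extension (Lmin a p Q) T -> real_operator T ->
     maximal_dissipative T \/ maximal_accumulative T -> self_adjoint T) /\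
  (forall K : 'M[R[i]]_(m * 2), K \is unitarymx ->
     (real_operator (L_sub a p Q K) <-> K = K^T) /\
     (real_operator (L_sup a p Q K) <-> K = K^T)).
Proof.
split=> [T _ Treal [Tdis|Tacc]|K KU].
- exact: real_maximal_dissipative_self_adjoint.
- exact: real_maximal_accumulative_self_adjoint.
- by split; [exact: real_L_sub|exact: real_L_sup].
Qed.
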